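(* For $x\in(0,1]$ and $v>0$ with $x^2v\ge2$, $$\frac1\pi\sum_{n\le v}\frac{\tau(n)}{n}\sin(2\pi nx)+\frac x\pi\sum_{n\le x^2v}\frac{\tau(n)}{n}\sin(2\pi n/x)=-\frac12\log x-F(x)+O\big((x^2v)^{-1/2}\log^2(x^2v)\big),$$ where the implied constant is absolute.
   Context: $\tau(n)$ is the number of positive divisors of the positive integer $n$; sums are over positive integers $n$. $\{t\}$ is the fractional part of $t$, $A(\lambda)=\int_0^\infty\{t\}\{\lambda t\}\,t^{-2}dt$ for $\lambda\ge0$, and $F(x)=\frac{x+1}{2}A(1)-A(x)-\frac x2\log x$ for $x>0$. *)

(* Defs.v *)
From mathcomp Require Import all_boot all_order all_algebra.
From mathcomp Require Import all_classical all_reals all_analysis.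

Set Implicit Arguments.
Unset Strict Implicit.
Unset Printing Implicit Defensive.

Import Order.TTheory GRing.Theory Num.Theory.
Import numFieldNormedType.Exports.

Local Open Scope classical_set_scope.
Local Open Scope ring_scope.

Definition tau (n : nat) : nat := size (divisors n).

Definition frac (R : realType) (t : R) : R := t - (Num.floor t)%:~R.

(* A(lambda) is meant for 0 <= lambda. The integrand is then nonnegative and
   integrable (it tends to lambda at 0+ and is at most t^-2), so that the
   real-valued Lebesgue integral is the usual one. *)
Definition autocorr (R : realType) (lambda : R) : R :=
  \int[@lebesgue_measure R]_(t in `]0, +oo[)
    (frac t * frac (lambda * t) / t ^+ 2).

Definition F (R : realType) (x : R) : R :=
  (x + 1) / 2 * autocorr 1 - autocorr x - x / 2 * ln x.

(* The sum of (tau(n) / n) sin(2 pi n y) over the positive integers n <= w,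
   for w >= 0: Num.truncn w is then the integer part of w. *)
Definition sin_sum (R : realType) (w y : R) : R :=
  \sum_(1 <= n < (Num.truncn w).+1)
    (tau n)%:R / n%:R * sin (2 * pi * n%:R * y).

(* Main.v *)
Require Import Defs.
From mathcomp Require Import all_boot all_order all_algebra.
From mathcomp Require Import all_classical all_reals all_analysis.
From mathcomp Require Import measurable_realfun ring lra.

(** Put [M = sqrt v] and [T = M * x], so that [T ^+ 2 = x ^+ 2 * v]; the claim
    is an equality up to [O (ln T ^+ 2 / T)], and the proof gives
    [O ((1 + ln T) / T)].

    The Dirichlet hyperbola method ([sin_sum_hyperbola]) rewrites the two sine
    sums as sums over [m <= M] and [h <= T] of [1 / m], respectively [1 / h],
    times partial sums of the Fourier series of the sawtooth [1/2 - {t}] taken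
    at [t = m x], respectively [t = h / x].  Each partial sum is the sawtooth
    minus a tail ([sin_sum_tails]), which leaves two things to study.

    The sawtooth part, [saw_sum M x], is known almost exactly.  On [0 < t <= M]
    the integrand [{t} {x t} / t ^ 2] of the autocorrelation is a finite
    combination of truncated powers of [t], since the integer parts only count
    lattice points; its integral contains the sum of [min (1/m) (x/k)] over the
    lattice points [(m, k)], and counting those on either side of the line
    [k = m x] turns this sum into [saw_sum M x] ([min_sumE]).  What remains are
    logarithmic and harmonic sums.  At [x = 1] the sawtooth vanishes at all the
    points involved, so that the same identity evaluates the logarithmic sums by
    autocorrelations at [1]: this is [saw_sum_reciprocity], which yields the
    main term [- (ln x) / 2 - F x] with an error [O (1 / T)]
    ([saw_sum_approx]).

    The tails are not small one by one: the tail of the [K]-th partial sum at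
    distance [s] from an integer has size about [min 1 (1 / (K s))].  They
    cancel in pairs.  If [h / x] lies at a small signed distance [d] from its
    nearest integer [m], then [m x] lies at distance [- x d] from [h]; the tail
    is odd in the distance and, up to [O (1 / K)], depends on [(2 K + 1) s]
    only ([saw_tail0_compare]), and the cutoffs of the two sums are in the ratio
    [x].  Hence the terms of index [m] and [h] compensate
    ([compare_fixed_cutoff], [compare_hyperbola_cutoff]).  An index [m] that is
    not paired in this way has [m x] at distance at least [x / 2] from the
    integers, up to two exceptions, and there the decay of the tail suffices
    ([paired_tails]). *)

Set Implicit Arguments.
Unset Strict Implicit.
Unset Printing Implicit Defensive.

Import Order.TTheory GRing.Theory Num.Theory.
Import numFieldNormedType.Exports.

Local Open Scope ring_scope.

(** * Comparison of increments and elementary trigonometric bounds *)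

(** Replaces integration in the estimates of the tails: instead of integrating
    an oscillating derivative, one compares its primitive with an explicit one. *)
Lemma norm_increment_le (R : realType) (f f' g g' : R -> R) (a b : R) : a <= b ->
  (forall t, a <= t <= b -> is_derive t 1 f (f' t)) ->
  (forall t, a <= t <= b -> is_derive t 1 g (g' t)) ->
  (forall t, a <= t <= b -> `|f' t| <= g' t) ->
  `|f b - f a| <= g b - g a.
Proof.
move=> ab df dg fg.
have up (h h' : R -> R) : (forall t, a <= t <= b -> is_derive t 1 h (h' t)) ->
    (forall t, a <= t <= b -> 0 <= h' t) -> h a <= h b.
  move=> dh h0; case: (ltgtP a b) ab => // [ltab _|->//].
  have [t|t tab|c] := @MVT R h h' a b ltab.
  - by rewrite in_itv /= => /andP[ta tb]; apply: dh; rewrite !ltW.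
  - apply/derivable_within_continuous => u; rewrite in_itv /= => uab.
    exact: (@ex_derive _ _ _ _ _ _ _ (dh u uab)).
  rewrite in_itv /= => /andP[ca cb] e.
  by rewrite -subr_ge0 e mulr_ge0 ?subr_ge0 ?h0 // !ltW.
have H1 : g a - f a <= g b - f b.
  apply: (up (fun t => g t - f t) (fun t => g' t - f' t)) => t tab.
    by have := df t tab; have := dg t tab => ? ?; apply: is_deriveB.
  by have := fg t tab; rewrite ler_norml subr_ge0 => /andP[].
have H2 : g a + f a <= g b + f b.
  apply: (up (fun t => g t + f t) (fun t => g' t + f' t)) => t tab.
    by have := df t tab; have := dg t tab => ? ?; apply: is_deriveD.
  have := fg t tab; rewrite ler_norml => /andP[]; lra.
rewrite ler_norml; apply/andP; split; lra.
Qed.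

Lemma sin_le_id (R : realType) (b : R) : 0 <= b -> `|sin b| <= b.
Proof.
move=> b0.
have := @norm_increment_le R sin cos id (fun=> 1) 0 b b0 (fun t _ => is_derive_sin t)
  (fun t _ => is_derive_id t 1) (fun t _ => cos_max t).
by rewrite sin0 !subr0.
Qed.

Lemma cos_quadratic (R : realType) (b : R) : 0 <= b -> `|cos b - 1| <= b ^+ 2 / 2.
Proof.
move=> b0.
have := @norm_increment_le R cos (fun t => - sin t) (fun t => t ^+ 2 / 2) id 0 b b0
  (fun t _ => is_derive_cos t).
rewrite cos0 expr0n /= mul0r subr0; apply => t /andP[t0 _].
- by apply: is_derive_eq; rewrite /GRing.scale /=; field.
- by rewrite normrN sin_le_id.
Qed.

Lemma sin_cubic (R : realType) (b : R) : 0 <= b -> `|sin b - b| <= b ^+ 3 / 6.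
Proof.
move=> b0.
have := @norm_increment_le R (fun t => sin t - t) (fun t => cos t - 1)
  (fun t => t ^+ 3 / 6) (fun t => t ^+ 2 / 2) 0 b b0.
rewrite sin0 expr0n /= mul0r !subr0; apply => t /andP[t0 _].
- by apply: is_derive_eq; rewrite /GRing.scale /=; field.
- by rewrite cos_quadratic.
Qed.

(** * The sawtooth function and the tails of its Fourier series *)

(** The value 0 at the integers is the sum of the Fourier series there. *)
Definition sawtooth (R : realType) (t : R) : R :=
  if t == (Num.floor t)%:~R then 0 else 2^-1 - Defs.frac t.

Definition sin_partial (R : realType) (K : nat) (t : R) : R :=
  \sum_(1 <= k < K.+1) k%:R^-1 * sin (2 * pi * k%:R * t).

(** Includes the factor [pi]: the Fourier series of [pi * sawtooth t] is the sum
    of [sin (2 pi k t) / k]. *)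
Definition saw_tail (R : realType) (K : nat) (t : R) : R :=
  pi * sawtooth t - sin_partial K t.

(** The analytic expression of [saw_tail] on the interval ]0, 1[; unlike
    [saw_tail] it is differentiable at the end points. *)
Definition saw_tail0 (R : realType) (K : nat) (t : R) : R :=
  pi * (2^-1 - t) - sin_partial K t.

Lemma saw_nat (R : realType) (n : nat) : sawtooth (n%:R : R) = 0.
Proof. by rewrite /sawtooth [n%:R]pmulrn intrKfloor eqxx. Qed.

Lemma floor_addn (R : realType) (n : nat) (s : R) : 0 <= s < 1 ->
  Num.floor (n%:R + s) = n%:Z.
Proof.
move=> /andP[s0 s1]; apply: floor_def; rewrite intrD -pmulrn /=.
by rewrite lerDl s0 ltrD2l.
Qed.

Lemma floor_subn (R : realType) (n : nat) (s : R) : 0 < s <= 1 ->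
  Num.floor (n%:R - s) = n%:Z - 1.
Proof.
move=> /andP[s0 s1]; apply: floor_def.
rewrite subrK intrB -!pmulrn /=; apply/andP; split; lra.
Qed.

Lemma saw_addn (R : realType) (n : nat) (s : R) : 0 < s < 1 ->
  sawtooth (n%:R + s) = 2^-1 - s.
Proof.
move=> /andP[s0 s1]; rewrite /sawtooth /Defs.frac floor_addn ?(ltW s0) // -pmulrn.
rewrite ifF; first by ring.
by apply/negbTE/eqP => e; move: s0; rewrite -[s](addKr n%:R) e; lra.
Qed.

Lemma saw_subn (R : realType) (n : nat) (s : R) : 0 < s < 1 ->
  sawtooth (n%:R - s) = - (2^-1 - s).
Proof.
move=> /andP[s0 s1]; rewrite /sawtooth /Defs.frac floor_subn ?s0 ?(ltW s1) // intrB -pmulrn.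
by rewrite ifF; [field|apply/negbTE/eqP => e; lra].
Qed.

Lemma sin_addn2pi (R : realType) (m : nat) (a : R) :
  sin (2 * pi * m%:R + a) = sin a.
Proof.
rewrite addrC (_ : 2 * pi * m%:R = pi *+ 2 *+ m) ?(periodicn (@sinD2pi R)) //.
by rewrite -[RHS]mulr_natr -[pi *+ 2]mulr_natr; ring.
Qed.

Lemma sin_partial_addn (R : realType) (K n : nat) (s : R) :
  sin_partial K (n%:R + s) = sin_partial K s.
Proof.
apply: eq_bigr => k _; congr (_ * _).
by rewrite mulrDr -[2 * pi * k%:R * n%:R]mulrA -natrM sin_addn2pi.
Qed.

Lemma sin_partialN (R : realType) (K : nat) (s : R) :
  sin_partial K (- s) = - sin_partial K s.
Proof.
by rewrite /sin_partial -sumrN; apply: eq_bigr => k _; rewrite mulrN sinN mulrN.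
Qed.

Lemma saw_tail_nat (R : realType) (K n : nat) : saw_tail K (n%:R : R) = 0.
Proof.
rewrite /saw_tail saw_nat -[n%:R]addr0 sin_partial_addn /sin_partial.
by rewrite big1 ?mulr0 ?subr0 // => k _; rewrite mulr0 sin0 mulr0.
Qed.

(** With [saw_tail_subn]: near an integer the tail is an odd function of the
    signed distance to that integer. *)
Lemma saw_tail_addn (R : realType) (K n : nat) (s : R) : 0 < s < 1 ->
  saw_tail K (n%:R + s) = saw_tail0 K s.
Proof. by move=> s01; rewrite /saw_tail saw_addn // sin_partial_addn. Qed.

Lemma saw_tail_subn (R : realType) (K n : nat) (s : R) : 0 < s < 1 ->
  saw_tail K (n%:R - s) = - saw_tail0 K s.
Proof.
move=> s01; rewrite /saw_tail saw_subn // sin_partial_addn sin_partialN /saw_tail0; ring.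
Qed.

Lemma is_derive_sin_partial (R : realType) (K : nat) (t : R) :
  is_derive t 1 (@sin_partial R K)
    (\sum_(1 <= k < K.+1) 2 * pi * cos (2 * pi * k%:R * t)).
Proof.
elim: K => [|K IH].
  rewrite big_geq // (_ : @sin_partial R 0 = cst 0); first exact: is_derive_cst.
  by apply/funext => u; rewrite /sin_partial big_geq.
rewrite big_nat_recr //= (_ : @sin_partial R K.+1 =
  fun u => sin_partial K u + K.+1%:R^-1 * sin (2 * pi * K.+1%:R * u)); last first.
  by apply/funext => u; rewrite /sin_partial big_nat_recr.
have hK : K.+1%:R != 0 :> R by rewrite pnatr_eq0.
by apply: is_derive_eq; rewrite /GRing.scale /=; field.
Qed.

(** Telescopes, since [2 sin (pi t) cos (2 pi k t)] is the difference of the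
    values of [sin] at [(2 k + 1) pi t] and [(2 k - 1) pi t]. *)
Lemma dirichlet_kernel (R : realType) (K : nat) (t : R) :
  sin (pi * t) * \sum_(1 <= k < K.+1) 2 * pi * cos (2 * pi * k%:R * t) =
  pi * (sin ((2 * K%:R + 1) * (pi * t)) - sin (pi * t)).
Proof.
elim: K => [|K IH]; first by rewrite big_geq // mulr0 mulr0 add0r mul1r subrr mulr0.
rewrite big_nat_recr //= mulrDr IH -[K.+1]addn1 natrD.
have -> : (2 * (K%:R + 1) + 1) * (pi * t) = 2 * pi * (K%:R + 1) * t + pi * t by ring.
have -> : (2 * K%:R + 1) * (pi * t) = 2 * pi * (K%:R + 1) * t - pi * t by ring.
by rewrite sinB sinD; ring.
Qed.

Lemma is_derive_saw_tail0 (R : realType) (K : nat) (t : R) : sin (pi * t) != 0 ->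
  is_derive t 1 (@saw_tail0 R K)
    (- pi * sin ((2 * K%:R + 1) * (pi * t)) / sin (pi * t)).
Proof.
move=> s0; have d := is_derive_sin_partial K t.
rewrite (_ : @saw_tail0 R K = fun u => pi * (2^-1 - u) - sin_partial K u) //.
apply: is_derive_eq; rewrite /GRing.scale /=.
apply: (mulfI s0); have := dirichlet_kernel K t.
set S := \sum_(1 <= k < K.+1) _ => e.
apply: (@eq_trans _ _ (- pi * sin (pi * t) - sin (pi * t) * S)); first by ring.
by rewrite e; field.
Qed.

(** * Size of the tails *)

Lemma sin_ge_third (R : realType) (s : R) : 0 <= s <= 2 -> s / 3 <= sin s.
Proof.
move=> /andP[s0 s2]; have := sin_cubic s0; rewrite ler_norml => /andP[h _].
have : s ^+ 3 <= 4 * s by rewrite exprSr ler_wpM2r // -[4](_ : 2 ^+ 2 = _) ?lerXn2r ?nnegrE //; ring.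
lra.
Qed.

Lemma pi_le4 (R : realType) : pi <= 4 :> R.
Proof. by have := @pihalf_lt2 R; lra. Qed.

Lemma sin_pi_ge (R : realType) (t : R) : 0 <= t <= 2^-1 -> pi * t / 3 <= sin (pi * t).
Proof.
move=> /andP[t0 t1]; apply: sin_ge_third; rewrite mulr_ge0 ?pi_ge0 //=.
have := @pi_le4 R; have := @pi_ge0 R; nra.
Qed.

Lemma sin_pi_gt0 (R : realType) (t : R) : 0 < t <= 2^-1 -> 0 < sin (pi * t).
Proof.
move=> /andP[t0 t1]; apply: lt_le_trans (sin_pi_ge _); last by rewrite (ltW t0).
by rewrite divr_gt0 ?mulr_gt0 ?pi_gt0.
Qed.

Lemma odd_gt0 (R : realType) (K : nat) : 0 < 2 * K%:R + 1 :> R.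
Proof. by rewrite ltr_wpDl ?mulr_ge0. Qed.

Lemma sin_nat_pi (R : realType) (k : nat) : sin (pi * k%:R : R) = 0.
Proof.
elim: k => [|k IH]; first by rewrite mulr0 sin0.
by rewrite -[k.+1]addn1 natrD mulrDr mulr1 sinD IH sinpi mul0r mulr0 addr0.
Qed.

Lemma cos_odd_pihalf (R : realType) (K : nat) : cos ((2 * K%:R + 1) * (pi * 2^-1) : R) = 0.
Proof.
rewrite (_ : _ * _ = pi * K%:R + pi / 2); last by field.
by rewrite cosDpihalf sin_nat_pi oppr0.
Qed.

(** Normalises the primitive: the tail at [t] is the integral from [t] to [1/2]
    of [pi sin ((2 K + 1) pi u) / sin (pi u)]. *)
Lemma saw_tail0_half (R : realType) (K : nat) : saw_tail0 K (2^-1 : R) = 0.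
Proof.
rewrite /saw_tail0 subrr mulr0 sub0r /sin_partial big1 ?oppr0 // => k _.
by rewrite (_ : _ * 2^-1 = pi * k%:R) ?sin_nat_pi ?mulr0 //; field.
Qed.

(** One integration by parts in the integral representation of the tail.  The
    constant 3 absorbs the bound of [sin] from below by a third of its
    argument. *)
Lemma saw_tail0_decay (R : realType) (K : nat) (t : R) : 0 < t <= 2^-1 ->
  `|saw_tail0 K t| <= 3 / ((2 * K%:R + 1) * t).
Proof.
move=> /andP[t0 t1].
set a : R := 2 * K%:R + 1; have a0 : 0 < a by exact: odd_gt0.
have pi0 := @pi_gt0 R.
have sgt u : t <= u <= 2^-1 -> 0 < sin (pi * u).
  by move=> /andP[tu u1]; apply: sin_pi_gt0; rewrite (lt_le_trans t0 tu).
(* The subtracted cosine term is the boundary term of the integration by parts. *)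
have := @norm_increment_le R
  (fun u => saw_tail0 K u - cos (a * (pi * u)) / (a * sin (pi * u)))
  (fun u => pi * cos (pi * u) * cos (a * (pi * u)) / (a * sin (pi * u) ^+ 2))
  (fun u => - (a * sin (pi * u))^-1)
  (fun u => pi * cos (pi * u) / (a * sin (pi * u) ^+ 2)) t 2^-1 t1.
rewrite saw_tail0_half cos_odd_pihalf mul0r subr0 sin_pihalf mulr1 => H.
have {H}H : `|0 - (saw_tail0 K t - cos (a * (pi * t)) / (a * sin (pi * t)))| <=
   - a^-1 - - (a * sin (pi * t))^-1.
  apply: H => u tu.
  - have s0 := sgt u tu; have s1 : sin (pi * u) != 0 by rewrite gt_eqF.
    have s2 : a * sin (pi * u) != 0 by rewrite mulf_neq0 ?gt_eqF.
    have d := is_derive_saw_tail0 K s1.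
    apply: is_derive_eq; rewrite /GRing.scale /= -/a.
    by field; rewrite s1 gt_eqF.
  - have s0 := sgt u tu; have s1 : sin (pi * u) != 0 by rewrite gt_eqF.
    have s2 : a * sin (pi * u) != 0 by rewrite mulf_neq0 ?gt_eqF.
    apply: is_derive_eq; rewrite /GRing.scale /=.
    by field; rewrite s1 gt_eqF.
  - have s0 := sgt u tu.
    have c0 : 0 <= cos (pi * u).
      move: tu => /andP[tu u1]; apply: cos_ge0_pihalf; apply/andP; split; nra.
    have p0 : 0 <= pi * cos (pi * u) / (a * sin (pi * u) ^+ 2).
      by rewrite divr_ge0 ?mulr_ge0 ?sqr_ge0 // ltW.
    rewrite mulrAC normrM (ger0_norm p0).
    by rewrite ler_piMr ?cos_max.
have s0 : 0 < sin (pi * t) by apply: sgt; rewrite lexx.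
have s0' : 0 < a * sin (pi * t) by rewrite mulr_gt0.
have H2 : `|cos (a * (pi * t)) / (a * sin (pi * t))| <= (a * sin (pi * t))^-1.
  by rewrite normrM [`|_^-1|]ger0_norm ?invr_ge0 ?(ltW s0') // ler_piMl ?cos_max // invr_ge0 ltW.
have H3 : 2 * (a * sin (pi * t))^-1 <= 3 / (a * t).
  have h := @sin_pi_ge R t; rewrite (ltW t0) t1 in h; have {}h := h isT.
  rewrite ler_pdivlMr ?mulr_gt0 // mulrAC ler_pdivrMr //.
  have := @pi_ge2 R => p2.
  have : 2 * t <= 3 * sin (pi * t) by nra.
  by nra.
have ai : 0 < a^-1 by rewrite invr_gt0.
move: H H2; rewrite sub0r normrN !ler_norml => /andP[h1 h2] /andP[h3 h4].
apply/andP; split; lra.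
Qed.

(** The tail tends to [pi / 2] at 0 from the right, at a rate that depends on
    [(2 K + 1) t] only; the partial sum is at most [2 pi K t] as [sin y <= y]. *)
Lemma saw_tail0_near0 (R : realType) (K : nat) (t : R) : 0 <= t ->
  `|saw_tail0 K t - pi / 2| <= pi * ((2 * K%:R + 1) * t).
Proof.
move=> t0; have pi0 := @pi_ge0 R.
have H : `|sin_partial K t| <= 2 * pi * t * K%:R.
  rewrite /sin_partial (le_trans (ler_norm_sum _ _ _)) //.
  apply: (@le_trans _ _ (\sum_(1 <= k < K.+1) (2 * pi * t))).
    rewrite big_nat_cond [leRHS]big_nat_cond.
    apply: ler_sum => k /andP[/andP[k1 _] _].
    have k0 : 0 < k%:R :> R by rewrite ltr0n.
    rewrite normrM ger0_norm ?invr_ge0 // mulrC ler_pdivrMr //.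
    rewrite (le_trans (sin_le_id _)) ?mulr_ge0 //.
    by rewrite -!mulrA [k%:R * t]mulrC.
  by rewrite sumr_const_nat subn1 mulr_natr.
rewrite (_ : _ - _ = - (pi * t) - sin_partial K t); last by rewrite /saw_tail0; field.
rewrite (le_trans (ler_normB _ _)) // normrN ger0_norm ?mulr_ge0 //.
lra.
Qed.

Lemma saw_tail0_bounded (R : realType) (K : nat) (t : R) : 0 < t <= 2^-1 ->
  `|saw_tail0 K t| <= 6.
Proof.
move=> t01; have /andP[t0 t1] := t01; have a0 := @odd_gt0 R K.
have at0 : 0 < (2 * K%:R + 1) * t by rewrite mulr_gt0.
have [h|h] := leP ((2 * K%:R + 1) * t) 1.
  have := saw_tail0_near0 K (ltW t0); have p4 := @pi_le4 R; have p0 := @pi_ge0 R.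
  have : pi * ((2 * K%:R + 1) * t) <= 4 by nra.
  rewrite !ler_norml => h1 /andP[h2 h3]; apply/andP; split; lra.
apply: le_trans (saw_tail0_decay K t01) _.
by rewrite ler_pdivrMr //; lra.
Qed.

(** The derivative of the tail at [t] is at most [3 / t], whatever [K]. *)
Lemma saw_tail0_lip (R : realType) (K : nat) (u v : R) : 0 < u -> u <= v -> v <= 2^-1 ->
  `|saw_tail0 K v - saw_tail0 K u| <= 3 * ((v - u) / u).
Proof.
move=> u0 uv v1; have pi0 := @pi_gt0 R.
have := @norm_increment_le R (@saw_tail0 R K)
  (fun t => - pi * sin ((2 * K%:R + 1) * (pi * t)) / sin (pi * t))
  (fun t => 3 / u * t) (fun=> 3 / u) u v uv.
rewrite (_ : 3 / u * v - _ = 3 * ((v - u) / u)); last by field; rewrite gt_eqF.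
apply=> t /andP[ut tv]; have t0 := lt_le_trans u0 ut; have t1 := le_trans tv v1.
- have s0 : 0 < sin (pi * t) by apply: sin_pi_gt0; rewrite t0.
  by apply: is_derive_saw_tail0; rewrite gt_eqF.
- by apply: is_derive_eq; rewrite /GRing.scale /= mulr1.
- have s0 : 0 < sin (pi * t) by apply: sin_pi_gt0; rewrite t0.
  have h := @sin_pi_ge R t; rewrite (ltW t0) t1 in h; have {}h := h isT.
  rewrite normrM normrM normrN (ger0_norm (ltW pi0)) [`|_^-1|]ger0_norm ?invr_ge0 ?(ltW s0) //.
  rewrite ler_pdivrMr // mulrAC ler_pdivlMr //.
  apply: (@le_trans _ _ (pi * t)); last by lra.
  rewrite ler_pM ?mulr_ge0 ?(ltW pi0) ?(ltW u0) //.
  by rewrite ler_piMr ?sin_max // ltW.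
Qed.

(** * Dependence of the tails on the cutoff *)

(** [1 / sin s - 1 / s] and its derivative are bounded up to [s = 0]; the bound
    on the derivative is [csc_cot_sub_inv_sqr].  Together they make the tail comparable with a function of [(2 K + 1) t]. *)
Lemma csc_sub_inv (R : realType) (s : R) : 0 < s <= 2 ->
  `|(sin s)^-1 - s^-1| <= 1.
Proof.
move=> /andP[s0 s2]; have /ltW s0' := s0.
have h : s / 3 <= sin s by apply: sin_ge_third; rewrite s0'.
have sp : 0 < sin s by apply: lt_le_trans h; rewrite divr_gt0.
have -> : (sin s)^-1 - s^-1 = - (sin s - s) / (s * sin s).
  by field; rewrite !gt_eqF.
rewrite normrM normrN [`|_^-1|]ger0_norm ?invr_ge0 ?mulr_ge0 // ?(ltW sp) //.
rewrite ler_pdivrMr ?mulr_gt0 // mul1r.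
apply: (le_trans (sin_cubic s0')); apply: (@le_trans _ _ (s * (s / 3))).
  rewrite (_ : s ^+ 3 / 6 = s * (s / 3) * (s / 2)); last by field.
  by rewrite ler_piMr ?mulr_ge0 ?divr_ge0 // ler_pdivrMr // mul1r.
by rewrite ler_wpM2l.
Qed.

Lemma csc_cot_sub_inv_sqr (R : realType) (s : R) : 0 < s <= 2 ->
  `|cos s / sin s ^+ 2 - s ^- 2| <= 5.
Proof.
move=> /andP[s0 s2]; have /ltW s0' := s0.
have h : s / 3 <= sin s by apply: sin_ge_third; rewrite s0'.
have sp : 0 < sin s by apply: lt_le_trans h; rewrite divr_gt0.
have -> : cos s / sin s ^+ 2 - s ^- 2 = (s ^+ 2 * cos s - sin s ^+ 2) / (s ^+ 2 * sin s ^+ 2).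
  by field; rewrite !gt_eqF.
have d0 : 0 < s ^+ 2 * sin s ^+ 2 by rewrite mulr_gt0 ?exprn_gt0.
rewrite normrM [`|_^-1|]ger0_norm ?invr_ge0 ?(ltW d0) // ler_pdivrMr //.
have h9 : s ^+ 4 <= 9 * (s ^+ 2 * sin s ^+ 2).
  rewrite (_ : s ^+ 4 = 9 * (s ^+ 2 * (s / 3) ^+ 2)); last by field.
  by rewrite ler_wpM2l // ler_wpM2l ?sqr_ge0 // lerXn2r ?nnegrE ?divr_ge0 ?(ltW sp).
suff : `|s ^+ 2 * cos s - sin s ^+ 2| <= s ^+ 4 / 2 by lra.
have := cos_quadratic s0'; have := sin_cubic s0'; have := sin_le_id s0'.
rewrite !ler_norml => /andP[_ k1] /andP[k2 _] /andP[k3 _].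
have c1 := cos_le1 s.
have e2 : 0 <= s ^+ 2 by rewrite sqr_ge0.
have m1 : s ^+ 2 * (1 - s ^+ 2 / 2) <= s ^+ 2 * cos s by rewrite ler_wpM2l //; lra.
have m2 : s ^+ 2 * cos s <= s ^+ 2 by rewrite ler_piMr.
have m3 : sin s ^+ 2 <= s ^+ 2 by rewrite lerXn2r ?nnegrE ?(ltW sp).
have m4 : (s - s ^+ 3 / 6) ^+ 2 <= sin s ^+ 2.
  rewrite lerXn2r ?nnegrE ?(ltW sp) //; last by lra.
  rewrite (_ : s - _ = s * (1 - s ^+ 2 / 6)); last by field.
  rewrite mulr_ge0 // subr_ge0 ler_pdivrMr // mul1r.
  by rewrite (@le_trans _ _ (2 ^+ 2)) ?lerXn2r ?nnegrE //; lra.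
have m5 : (s - s ^+ 3 / 6) ^+ 2 = s ^+ 2 - s ^+ 4 / 3 + (s ^+ 3 / 6) ^+ 2 by field.
have m6 : 0 <= (s ^+ 3 / 6) ^+ 2 by rewrite sqr_ge0.
have m7 : s ^+ 2 * (1 - s ^+ 2 / 2) = s ^+ 2 - s ^+ 4 / 2 by field.
have m8 : 0 <= s ^+ 4 by rewrite exprn_ge0.
apply/andP; split; lra.
Qed.

(** If [1 / sin (pi u)] were [1 / (pi u)], the tail would depend on
    [(2 K + 1) t] only.  The difference of the two tails is the integral of
    [sin ((2 K + 1) pi s)] against the difference of two bounded functions of
    bounded derivative, hence is small after one integration by parts. *)
Lemma saw_tail0_scale (R : realType) (K L : nat) (t u : R) :
  0 < t <= 2^-1 -> 0 < u <= 2^-1 -> (2 * K%:R + 1) * t = (2 * L%:R + 1) * u ->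
  `|saw_tail0 K t - saw_tail0 L u| <= 24 * ((2 * K%:R + 1)^-1 + (2 * L%:R + 1)^-1).
Proof.
move=> /andP[t0 t1] /andP[u0 u1].
set a : R := 2 * K%:R + 1; set b : R := 2 * L%:R + 1 => atbu.
have a0 : 0 < a by exact: odd_gt0.
have b0 : 0 < b by exact: odd_gt0.
have pi0 := @pi_gt0 R; have p4 := @pi_le4 R.
(* The substitution that carries the first integral to the second. *)
pose r := a / b; have r0 : 0 < r by rewrite divr_gt0.
have rt : r * t = u by rewrite /r mulrAC atbu mulrAC mulfV ?mul1r ?gt_eqF.
have rb : r * b = a by rewrite /r divfK ?gt_eqF.
pose w s := (sin (pi * s))^-1 - r / sin (pi * (r * s)).
pose w' s := pi * (r ^+ 2 * (cos (pi * (r * s)) / sin (pi * (r * s)) ^+ 2)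
   - cos (pi * s) / sin (pi * s) ^+ 2).
have dom s : 0 < s <= t -> [/\ 0 < sin (pi * s), 0 < sin (pi * (r * s)),
    0 < pi * s <= 2 & 0 < pi * (r * s) <= 2].
  move=> /andP[s0 st].
  have s1 : s <= 2^-1 by exact: le_trans st t1.
  have rs0 : 0 < r * s by rewrite mulr_gt0.
  have rs1 : r * s <= 2^-1 by rewrite (le_trans _ u1) // -rt ler_pM2l.
  split; [by apply: sin_pi_gt0; rewrite s0|by apply: sin_pi_gt0; rewrite rs0| |].
    by rewrite mulr_gt0 //=; nra.
  by rewrite mulr_gt0 //=; nra.
have wle s : 0 < s <= t -> `|w s| <= 1 + r.
  move=> st; have [s1 s2 s3 s4] := dom s st; have /andP[s0 _] := st.
  have -> : w s = ((sin (pi * s))^-1 - (pi * s)^-1)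
      - r * ((sin (pi * (r * s)))^-1 - (pi * (r * s))^-1).
    move: s1 s2 pi0; rewrite /w; set x := sin (pi * s); set y := sin (pi * (r * s)).
    clearbody x y; move: (pi : R) => p x0 y0 p0.
    by field; rewrite !gt_eqF.
  rewrite (le_trans (ler_normB _ _)) // lerD ?csc_sub_inv // normrM gtr0_norm //.
  by rewrite ler_piMr ?(ltW r0) ?csc_sub_inv.
have w'le s : 0 < s <= t -> `|w' s| <= 20 * (1 + r ^+ 2).
  move=> st; have [s1 s2 s3 s4] := dom s st; have /andP[s0 _] := st.
  have -> : w' s = pi * (r ^+ 2 * (cos (pi * (r * s)) / sin (pi * (r * s)) ^+ 2 -
       (pi * (r * s)) ^- 2) - (cos (pi * s) / sin (pi * s) ^+ 2 - (pi * s) ^- 2)).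
    move: s1 s2 pi0; rewrite /w'; set x := sin (pi * s); set y := sin (pi * (r * s)).
    set cx := cos (pi * s); set cy := cos (pi * (r * s)).
    clearbody x y cx cy; move: (pi : R) => p x0 y0 p0.
    by field; rewrite !gt_eqF.
  rewrite normrM gtr0_norm // (_ : 20 * _ = 4 * (5 * (1 + r ^+ 2))); last by ring.
  rewrite ler_pM ?(ltW pi0) // (le_trans (ler_normB _ _)) //.
  have := csc_cot_sub_inv_sqr s3; have := csc_cot_sub_inv_sqr s4.
  rewrite normrM (ger0_norm (sqr_ge0 _)); have := sqr_ge0 r; nra.
(* Boundary term of the integration by parts. *)
pose c s := cos (a * (pi * s)) * w s / a.
have cle s : 0 < s <= t -> `|c s| <= (1 + r) / a.
  move=> st; rewrite /c normrM [`|_^-1|]ger0_norm ?invr_ge0 ?(ltW a0) //.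
  rewrite ler_pM2r ?invr_gt0 // normrM.
  by apply: le_trans (wle s st); rewrite ler_piMl ?cos_max.
pose D s := saw_tail0 K s - saw_tail0 L (r * s).
(* At [e] both tails are within [O (1 / a)] of their common limit [pi / 2] at 0. *)
pose e := Num.min t (8 * a ^+ 2)^-1.
have e0 : 0 < e by rewrite lt_min t0 invr_gt0 mulr_gt0 ?exprn_gt0.
have et : e <= t by rewrite ge_min lexx.
have ea : a * e <= (8 * a)^-1.
  have : e <= (8 * a ^+ 2)^-1 by rewrite ge_min lexx orbT.
  rewrite -(ler_pM2l a0) => h; apply: le_trans h _.
  by rewrite le_eqVlt; apply/orP; left; apply/eqP; field; rewrite gt_eqF.
have De : `|D e| <= a^-1.
  have n1 := saw_tail0_near0 K (ltW e0).
  have n2 := saw_tail0_near0 L (ltW (mulr_gt0 r0 e0)).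
  have bre : b * (r * e) = a * e by rewrite mulrA [b * r]mulrC rb.
  rewrite -/a in n1; rewrite -/b bre in n2.
  have : pi * (a * e) <= a^-1 / 2.
    apply: (@le_trans _ _ (4 * (8 * a)^-1)).
      by rewrite ler_pM ?(ltW pi0) ?mulr_ge0 ?(ltW a0) ?(ltW e0).
    by rewrite le_eqVlt; apply/orP; left; apply/eqP; field; rewrite gt_eqF.
  move: n1 n2; rewrite /D !ler_norml => /andP[n1 n2] /andP[n3 n4] n5.
  clear -n1 n2 n3 n4 n5; apply/andP; split; lra.
pose G := 20 * (1 + r ^+ 2) / a.
have sdom s : e <= s <= t -> 0 < s <= t.
  by move=> /andP[es ->]; rewrite (lt_le_trans e0 es).
have d1 s : e <= s <= t -> is_derive s 1 (fun s => D s - c s) (- (cos (a * (pi * s)) * w' s / a)).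
  move=> /sdom sd; have [s1 s2 _ _] := dom s sd.
  have n1 : sin (pi * s) != 0 by rewrite gt_eqF.
  have n2 : sin (pi * (r * s)) != 0 by rewrite gt_eqF.
  have k1 := is_derive_saw_tail0 K n1; have k2 := is_derive_saw_tail0 L n2.
  rewrite /D /c /w; apply: is_derive_eq; rewrite /GRing.scale /= -/a -/b /w'.
  have -> : b * (pi * (r * s)) = a * (pi * s) by rewrite -rb; ring.
  move: n1 n2; set x := sin (pi * s); set y := sin (pi * (r * s)) => n1 n2.
  by field; rewrite n1 n2 gt_eqF.
have d2 s : e <= s <= t -> is_derive s 1 (fun s => G * s) G.
  by move=> _; apply: is_derive_eq; rewrite /GRing.scale /= mulr1.
have d3 s : e <= s <= t -> `|- (cos (a * (pi * s)) * w' s / a)| <= G.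
  move=> /sdom sd; rewrite normrN normrM [`|_^-1|]ger0_norm ?invr_ge0 ?(ltW a0) //.
  rewrite ler_pM2r ?invr_gt0 // normrM.
  by apply: le_trans (w'le s sd); rewrite ler_piMl ?cos_max.
have H : `|(D t - c t) - (D e - c e)| <= G * t - G * e := norm_increment_le et d1 d2 d3.
have ct := cle t; rewrite t0 lexx in ct; have {}ct := ct isT.
have ce := cle e; rewrite e0 et in ce; have {}ce := ce isT.
have rab : (1 + r) / a = a^-1 + b^-1.
  by rewrite /r; field; rewrite !gt_eqF.
have big : G * t <= 20 * ((1 + r) / a).
  rewrite /G mulrAC mulrA ler_pM2r ?invr_gt0 // -mulrA ler_pM2l //.
  by nra.
have ai : 0 < a^-1 by rewrite invr_gt0.
have bi : 0 < b^-1 by rewrite invr_gt0.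
have ebig : 0 <= G * e.
  by rewrite !mulr_ge0 ?invr_ge0 ?(ltW a0) ?(ltW e0) // addr_ge0 ?sqr_ge0.
rewrite -rt -/(D t); clearbody D c G.
move: H ct ce De; rewrite rab in big *; rewrite !ler_norml.
move=> /andP[h1 h2] /andP[h3 h4] /andP[h5 h6] /andP[h7 h8].
clear -h1 h2 h3 h4 h5 h6 h7 h8 big ebig ai bi; apply/andP; split; lra.
Qed.

(** Moves the point with the larger scaled distance until the two scaled
    distances agree, then changes the cutoff by [saw_tail0_scale]. *)
Lemma saw_tail0_compare (R : realType) (K L : nat) (t u y : R) :
  0 < t <= 2^-1 -> 0 < u <= 2^-1 -> 0 < y ->
  y <= (2 * K%:R + 1) * t -> y <= (2 * L%:R + 1) * u ->
  `|saw_tail0 K t - saw_tail0 L u| <= 24 * ((2 * K%:R + 1)^-1 + (2 * L%:R + 1)^-1)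
     + 3 * (`|(2 * K%:R + 1) * t - (2 * L%:R + 1) * u| / y).
Proof.
move=> t01 u01 y0.
wlog le : K L t u t01 u01 / (2 * K%:R + 1) * t <= (2 * L%:R + 1) * u.
  move=> W yt yu; have [h|/ltW h] := leP ((2 * K%:R + 1) * t) ((2 * L%:R + 1) * u).
    exact: W.
  by rewrite distrC [X in 24 * X]addrC [X in X / y]distrC; apply: W.
set a : R := 2 * K%:R + 1 in le *; set b : R := 2 * L%:R + 1 in le *.
move=> yt yu; have a0 : 0 < a by exact: odd_gt0.
have b0 : 0 < b by exact: odd_gt0.
have /andP[t0 t1] := t01; have /andP[u0 u1] := u01.
pose v := a * t / b; have v0 : 0 < v by rewrite divr_gt0 ?mulr_gt0.
have bv : b * v = a * t by rewrite /v mulrC divfK ?gt_eqF.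
have vu : v <= u by rewrite -(ler_pM2l b0) bv.
have v01 : 0 < v <= 2^-1 by rewrite v0 (le_trans vu).
have h1 := saw_tail0_scale t01 v01 (esym bv).
have h2 := saw_tail0_lip L v0 vu u1.
rewrite -[_ - _](subrKA (saw_tail0 L v)) (le_trans (ler_normD _ _)) // lerD //.
rewrite distrC (le_trans h2) // ler_wpM2l // distrC ger0_norm ?subr_ge0 //.
rewrite -bv -mulrBr (_ : (u - v) / v = b * (u - v) / (b * v)); last first.
  by field; rewrite !gt_eqF.
rewrite ler_wpM2l ?mulr_ge0 ?subr_ge0 ?(ltW b0) // lef_pV2 ?posrE ?mulr_gt0 ?invr_gt0 //.
by rewrite bv.
Qed.

(** * The hyperbola method *)

Lemma tau_sum_dvdn (R : realType) (V n : nat) : (0 < n <= V)%N ->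
  (tau n)%:R = \sum_(1 <= a < V.+1 | (a %| n)%N) 1 :> R.
Proof.
move=> /andP[n0 nV]; rewrite /tau -(natr_sum _ _ _ (fun=> 1%N)) sum1_count.
rewrite -size_filter; congr _%:R; apply: perm_size; apply: uniq_perm.
- exact: divisors_uniq.
- by rewrite filter_uniq // iota_uniq.
move=> a; rewrite -dvdn_divisors // mem_filter mem_index_iota.
have [an|//] := boolP (a %| n)%N.
by rewrite (dvdn_gt0 n0 an) ltnS (leq_trans (dvdn_leq n0 an)).
Qed.

Lemma sum_multiples (R : realType) (g : nat -> R) (V a : nat) : (0 < a)%N ->
  \sum_(1 <= n < V.+1 | (a %| n)%N) g n = \sum_(1 <= b < (V %/ a).+1) g (a * b)%N.
Proof.
move=> a0; rewrite -big_filter -[RHS](big_map (muln a) xpredT g).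
apply: perm_big; apply: uniq_perm.
- by rewrite filter_uniq // iota_uniq.
- rewrite map_inj_uniq ?iota_uniq // => b c /eqP.
  by rewrite eqn_pmul2l // => /eqP.
move=> n; rewrite mem_filter mem_index_iota; apply/idP/mapP.
  move=> /andP[/dvdnP[b ->] /andP[b1 bV]]; exists b; last by rewrite mulnC.
  rewrite mem_index_iota; rewrite !ltnS in bV *.
  by rewrite leq_divRL // bV andbT; move: b1; rewrite muln_gt0 => /andP[].
move=> [b]; rewrite mem_index_iota ltnS leq_divRL // => /andP[b0 bV] ->.
by rewrite dvdn_mulr // muln_gt0 a0 b0 ltnS mulnC.
Qed.

Lemma sum_tau (R : realType) (g : nat -> R) (V : nat) :
  \sum_(1 <= n < V.+1) (tau n)%:R * g n =
  \sum_(1 <= a < V.+1) \sum_(1 <= b < (V %/ a).+1) g (a * b)%N.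
Proof.
transitivity (\sum_(1 <= n < V.+1) \sum_(1 <= a < V.+1 | (a %| n)%N) g n).
  rewrite big_nat_cond [RHS]big_nat_cond; apply: eq_bigr => n /andP[/andP[n0 nV] _].
  rewrite (@tau_sum_dvdn R V) ?n0 // mulr_suml; apply: eq_bigr => a _; exact: mul1r.
rewrite (exchange_big_dep predT) //= big_nat_cond [RHS]big_nat_cond.
by apply: eq_bigr => a /andP[/andP[a0 _] _]; exact: sum_multiples.
Qed.

(** In a pair with product at most [V] one of the two factors is at most [p];
    the pairs with both factors at most [p] are counted twice. *)
Lemma hyperbola (R : realType) (h : nat -> nat -> R) (V p : nat) :
  (forall a b, h a b = h b a) -> (p * p <= V < p.+1 * p.+1)%N ->
  \sum_(1 <= a < V.+1) \sum_(1 <= b < (V %/ a).+1) h a b =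
  2 * (\sum_(1 <= a < p.+1) \sum_(1 <= b < (V %/ a).+1) h a b)
  - \sum_(1 <= a < p.+1) \sum_(1 <= b < p.+1) h a b.
Proof.
move=> hC /andP[pV Vp].
pose h' a b := if (a * b <= V)%N then h a b else 0.
have h'C a b : h' a b = h' b a by rewrite /h' mulnC hC.
have row a : (0 < a)%N ->
    \sum_(1 <= b < (V %/ a).+1) h a b = \sum_(1 <= b < V.+1) h' a b.
  move=> a0; rewrite [RHS](@big_cat_nat _ _ _ (V %/ a).+1) //=; last by rewrite ltnS leq_div.
  rewrite [X in _ + X]big_nat_cond [X in _ + X]big1 ?addr0; last first.
    move=> b /andP[/andP[b1 _] _]; rewrite /h' ifF //; apply/negbTE.
    by rewrite -ltnNge mulnC -ltn_divLR.
  rewrite big_nat_cond [RHS]big_nat_cond; apply: eq_bigr => b /andP[/andP[_ bV] _].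
  by rewrite /h' ifT // mulnC -leq_divRL.
have rows n : \sum_(1 <= a < n) \sum_(1 <= b < (V %/ a).+1) h a b =
    \sum_(1 <= a < n) \sum_(1 <= b < V.+1) h' a b.
  rewrite big_nat_cond [RHS]big_nat_cond.
  by apply: eq_bigr => a /andP[/andP[a0 _] _]; exact: row.
have pV' : (p <= V)%N by case: (p) pV => // k; apply: leq_trans; rewrite leq_pmulr.
rewrite !rows (@big_cat_nat _ _ _ p.+1) //=.
have -> : \sum_(1 <= a < p.+1) \sum_(1 <= b < p.+1) h a b =
    \sum_(1 <= a < p.+1) \sum_(1 <= b < p.+1) h' a b.
  rewrite big_nat_cond [RHS]big_nat_cond; apply: eq_bigr => a /andP[/andP[_ ap] _].
  rewrite big_nat_cond [RHS]big_nat_cond; apply: eq_bigr => b /andP[/andP[_ bp] _].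
  by rewrite /h' ifT // (leq_trans _ pV) // leq_mul.
suff -> : \sum_(p.+1 <= a < V.+1) \sum_(1 <= b < V.+1) h' a b =
    \sum_(1 <= a < p.+1) \sum_(1 <= b < V.+1) h' a b -
    \sum_(1 <= a < p.+1) \sum_(1 <= b < p.+1) h' a b by ring.
transitivity (\sum_(p.+1 <= a < V.+1) \sum_(1 <= b < p.+1) h' a b).
  rewrite big_nat_cond [RHS]big_nat_cond; apply: eq_bigr => a /andP[/andP[ap _] _].
  rewrite (@big_cat_nat _ _ _ p.+1) //= [X in _ + X]big_nat_cond [X in _ + X]big1 ?addr0 //.
  move=> b /andP[/andP[bp _] _]; rewrite /h' ifF //; apply/negbTE.
  by rewrite -ltnNge (leq_trans Vp) // leq_mul.
rewrite exchange_big_nat -sumrB /=; apply: eq_bigr => b _.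
rewrite [X in _ = X - _](@big_cat_nat _ _ _ p.+1) //= addrAC.
rewrite (eq_bigr (fun a => h' b a)) //.
by rewrite subrr add0r.
Qed.

Lemma sin_sum_hyperbola (R : realType) (w y : R) (p : nat) :
  let V := Num.truncn w in (p * p <= V < p.+1 * p.+1)%N ->
  sin_sum w y =
    2 * (\sum_(1 <= a < p.+1) a%:R^-1 * sin_partial (V %/ a) (a%:R * y))
    - \sum_(1 <= a < p.+1) a%:R^-1 * sin_partial p (a%:R * y).
Proof.
move=> V pV; pose g n : R := n%:R^-1 * sin (2 * pi * n%:R * y).
have E K a : a%:R^-1 * sin_partial K (a%:R * y) = \sum_(1 <= b < K.+1) g (a * b)%N.
  rewrite /sin_partial mulr_sumr; apply: eq_bigr => b _.
  rewrite /g natrM invfM mulrA; congr (_ * sin _); ring.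
rewrite (eq_bigr _ (fun a _ => E _ a)) [X in _ - X](eq_bigr _ (fun a _ => E _ a)).
rewrite -(@hyperbola _ (fun a b => g (a * b)%N) V p) => [|a b|//]; last by rewrite mulnC.
by rewrite -sum_tau /sin_sum; apply: eq_bigr => n _; rewrite mulrA.
Qed.

(** * Reciprocity for the sawtooth sums *)

Definition harmonic_sum (R : realType) (n : nat) : R :=
  \sum_(1 <= k < n.+1) k%:R^-1.

(** The integral over ]0, t] of the integer part of [u] divided by [u]. *)
Definition log_sum (R : realType) (t : R) : R :=
  \sum_(1 <= k < (Num.truncn t).+1) ln (t / k%:R).

(** The integral over ]0, M] of the product of the integer parts of [t] and
    [x t], divided by [t ^+ 2], up to the boundary term in [autocorr_trunc]. *)
Definition min_sum (R : realType) (M x : R) : R :=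
  \sum_(1 <= m < (Num.truncn M).+1) \sum_(1 <= k < (Num.truncn (M * x)).+1)
    Num.min m%:R^-1 (x / k%:R).

Definition saw_sum (R : realType) (M x : R) : R :=
  \sum_(1 <= m < (Num.truncn M).+1) sawtooth (m%:R * x) / m%:R
  + x * \sum_(1 <= k < (Num.truncn (M * x)).+1) sawtooth (k%:R / x) / k%:R.

(** Closed form of the integral defining [autocorr x], taken over ]0, M] only. *)
Definition autocorr_trunc (R : realType) (M x : R) : R :=
  x * M - x * log_sum M - log_sum (M * x)
  + (min_sum M x - (Num.truncn M)%:R * (Num.truncn (M * x))%:R / M).

(** A half unit on the diagonal makes the count of lattice points symmetric in
    the two coordinates and matches the value of [sawtooth] at the integers. *)
Definition half_step (R : realType) (t s : R) : R :=
  if s < t then 1 else if s == t then 2^-1 else 0.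

Lemma sum_half_step (R : realType) (t : R) (q : nat) : 0 < t < q.+1%:R ->
  \sum_(1 <= k < q.+1) half_step t k%:R = t - 2^-1 + sawtooth t.
Proof.
move=> /andP[t0 tq]; have /andP[nt tn] := truncn_itv (ltW t0).
set n := Num.truncn t in nt tn.
have nq : (n <= q)%N by rewrite -ltnS -(ltr_nat R) (le_lt_trans nt).
have lo m : m%:R <= t -> \sum_(1 <= k < m) half_step t k%:R = m.-1%:R.
  move=> mt; rewrite (eq_big_nat _ _ (F2 := fun=> 1)).
    by rewrite sumr_const_nat subn1.
  by move=> k /andP[_ km]; rewrite /half_step ifT // (lt_le_trans _ mt) // ltr_nat.
have hi : \sum_(n.+1 <= k < q.+1) half_step t k%:R = 0.
  rewrite big_nat_cond big1 // => k /andP[/andP[nk _] _].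
  have tk : t < k%:R by rewrite (lt_le_trans tn) // ler_nat.
  by rewrite /half_step ltNge (ltW tk) /= gt_eqF.
rewrite (@big_cat_nat _ _ _ n.+1) //= hi addr0.
move: nt; rewrite le_eqVlt => /predU1P[e|nt].
  case: n e {tn nq hi} => [|n] e; first by move: t0; rewrite -e ltxx.
  rewrite big_nat_recr //= lo ?e //= /half_step ltxx eqxx -[in sawtooth _]e saw_nat.
  by rewrite -e -natr1; field.
have -> : sawtooth t = 2^-1 - (t - n%:R).
  by rewrite -[in LHS](subrKC n%:R t) saw_addn // subr_gt0 nt ltrBlDl natr1.
case: n nt {tn nq hi} => [|n] nt; first by rewrite big_geq //; ring.
by rewrite big_nat_recr //= lo ?(ltW nt) // /half_step nt -natr1; field.
Qed.

(** Each lattice point contributes the term of its own side of the line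
    [k = m x], and half of both on the line, where they coincide. *)
Lemma min_half_step (R : realType) (x m k : R) : 0 < x -> 0 < m -> 0 < k ->
  Num.min m^-1 (x / k) = m^-1 * half_step (m * x) k + x / k * half_step (k / x) m.
Proof.
move=> x0 m0 k0.
have xk : (m^-1 < x / k) = (k < m * x) by rewrite ltr_pdivlMr // ltr_pdivrMl // mulrC.
have mk : (m < k / x) = (m * x < k) by rewrite ltr_pdivlMr.
have mke : (m == k / x) = (k == m * x).
  by apply/eqP/eqP => ->; rewrite ?divfK ?mulfK ?gt_eqF.
rewrite /half_step minElt xk mk mke.
case: ltgtP => [h|h|->]; rewrite ?mulr0 ?mulr1 ?add0r ?addr0 //.
by field; rewrite !gt_eqF.
Qed.

Lemma min_sumE (R : realType) (M x : R) : 0 < M -> 0 < x ->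
  let p := Num.truncn M in let q := Num.truncn (M * x) in
  min_sum M x = x * p%:R - harmonic_sum R p / 2 + q%:R - x * harmonic_sum R q / 2
    + saw_sum M x.
Proof.
move=> M0 x0 p q; have T0 : 0 < M * x by rewrite mulr_gt0.
have /andP[pM Mp] := truncn_itv (ltW M0); have /andP[qT Tq] := truncn_itv (ltW T0).
rewrite -/p in pM Mp; rewrite -/q in qT Tq.
pose f m k : R := m%:R^-1 * half_step (m%:R * x) k%:R.
pose g m k : R := x / k%:R * half_step (k%:R / x) m%:R.
have -> : min_sum M x = \sum_(1 <= m < p.+1) \sum_(1 <= k < q.+1) f m k +
    \sum_(1 <= k < q.+1) \sum_(1 <= m < p.+1) g m k.
  rewrite [X in _ + X]exchange_big_nat -big_split /=; apply: eq_big_nat => m /andP[m0 _].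
  rewrite -big_split /=; apply: eq_big_nat => k /andP[k0 _].
  by rewrite min_half_step // ltr0n.
have -> : \sum_(1 <= m < p.+1) \sum_(1 <= k < q.+1) f m k =
    \sum_(1 <= m < p.+1) (x - 2^-1 * m%:R^-1 + sawtooth (m%:R * x) / m%:R).
  apply: eq_big_nat => m /andP[m0 mp]; have mr0 : 0 < m%:R :> R by rewrite ltr0n.
  rewrite -mulr_sumr sum_half_step; first by field; rewrite gt_eqF.
  rewrite mulr_gt0 //= (le_lt_trans _ Tq) // ler_pM2r // (le_trans _ pM) // ler_nat.
  by rewrite -ltnS.
have -> : \sum_(1 <= k < q.+1) \sum_(1 <= m < p.+1) g m k =
    \sum_(1 <= k < q.+1) (1 - x / 2 * k%:R^-1 + x * (sawtooth (k%:R / x) / k%:R)).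
  apply: eq_big_nat => k /andP[k0 kq]; have kr0 : 0 < k%:R :> R by rewrite ltr0n.
  rewrite -mulr_sumr sum_half_step; first by field; rewrite !gt_eqF.
  rewrite divr_gt0 //= (le_lt_trans _ Mp) // ler_pdivrMr // (le_trans _ qT) // ler_nat.
  by rewrite -ltnS.
rewrite !big_split /= !sumr_const_nat !subn1 /= !sumrN -!mulr_sumr.
rewrite -/(harmonic_sum R p) -/(harmonic_sum R q) /saw_sum -/p -/q.
by rewrite -[x *+ p]mulr_natr; field.
Qed.

Lemma saw_sum1 (R : realType) (M : R) : saw_sum M 1 = 0.
Proof.
rewrite /saw_sum !big1 ?mulr0 ?addr0 // => k _.
  by rewrite divr1 saw_nat mul0r.
by rewrite mulr1 saw_nat mul0r.
Qed.

(** The logarithmic sums at [M] and [M * x] are eliminated by the case [x = 1]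
    at these two scales, where the sawtooth sum vanishes. *)
Lemma saw_sum_reciprocity (R : realType) (M x : R) : 0 < M -> 0 < x ->
  let p := Num.truncn M in let q := Num.truncn (M * x) in
  saw_sum M x = autocorr_trunc M x - x / 2 * autocorr_trunc M 1
    - 2^-1 * autocorr_trunc (M * x) 1
    + (1 - x) / 2 * (harmonic_sum R p - harmonic_sum R q)
    - (x * p%:R - q%:R) ^+ 2 / (2 * (M * x)).
Proof.
move=> M0 x0 p q; have T0 : 0 < M * x by rewrite mulr_gt0.
rewrite /autocorr_trunc !min_sumE // !saw_sum1 !mulr1 -/p -/q.
by field; rewrite !gt_eqF.
Qed.

(** * The autocorrelation integral truncated at M *)

Section TruncatedAutocorrelation.
Local Open Scope classical_set_scope.
Local Open Scope ring_scope.

(** Keeps integrability and value together, so that linear combinations need no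
    separate integrability proofs. *)
Definition has_integral (R : realType) (D : set (measurableTypeR R)) (f : R -> R) (v : R) : Prop :=
  (@lebesgue_measure R).-integrable D (EFin \o f) /\
  \int[@lebesgue_measure R]_(t in D) f t = v.

Section HasIntegral.
Variables (R : realType) (D : set (measurableTypeR R)).
Hypothesis mD : measurable D.

Lemma has_integralD (f g : R -> R) (u v : R) :
  has_integral D f u -> has_integral D g v ->
  has_integral D (fun t => f t + g t) (u + v).
Proof.
move=> [fi <-] [gi <-]; split; last by rewrite RintegralD.
exact: (integrableD mD fi gi).
Qed.

Lemma has_integralZ (f : R -> R) (c u : R) :
  has_integral D f u -> has_integral D (fun t => c * f t) (c * u).
Proof.
move=> [fi <-]; split; last by rewrite RintegralZl.
exact: (integrableZl mD c fi).
Qed.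

Lemma has_integral0 : has_integral D (fun=> 0) 0.
Proof.
split; first exact: integrable0.
by rewrite Rintegral_cst // mul0r.
Qed.

Lemma has_integral_sum (f : nat -> R -> R) (v : nat -> R) (m n : nat) :
  (forall k, (m <= k < n)%N -> has_integral D (f k) (v k)) ->
  has_integral D (fun t => \sum_(m <= k < n) f k t) (\sum_(m <= k < n) v k).
Proof.
move=> H; have [nm|mn] := leqP n m.
  have -> : (fun t => \sum_(m <= k < n) f k t) = fun=> 0.
    by apply/funext => t; rewrite big_geq.
  by rewrite big_geq //; exact: has_integral0.
elim: n mn H => // n IH; rewrite ltnS leq_eqVlt => /predU1P[<-|mn] H.
  have -> : (fun t => \sum_(m <= k < m.+1) f k t) = f m.
    by apply/funext => t; rewrite big_nat1.
  by rewrite big_nat1; apply: H; rewrite leqnn ltnSn.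
have -> : (fun t => \sum_(m <= k < n.+1) f k t) =
    fun t => \sum_(m <= k < n) f k t + f n t.
  by apply/funext => t; rewrite big_nat_recr // ltnW.
rewrite big_nat_recr ?(ltnW mn) //; apply: has_integralD.
  by apply: IH => // k /andP[mk kn]; apply: H; rewrite mk (ltn_trans kn).
by apply: H; rewrite ltnSn (ltnW mn).
Qed.

Lemma has_integral_eq (f g : R -> R) (v : R) :
  (forall t, D t -> f t = g t) -> has_integral D f v -> has_integral D g v.
Proof.
move=> fg [fi <-]; split.
  by apply: (eq_integrable mD (EFin \o f)) fi => t /set_mem tD /=; rewrite fg.
by apply: eq_Rintegral => t /set_mem tD; rewrite fg.
Qed.

End HasIntegral.

(** The case of a term [1 / t] or [1 / t ^+ 2] that is switched on at a lattice
    point [a]. *)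
Lemma has_integral_cut (R : realType) (a M : R) (f F : R -> R) : 0 < a -> a <= M ->
  (forall t : R, 0 < t -> is_derive t 1 F (f t)) ->
  (forall t : R, 0 < t -> derivable f t 1) ->
  has_integral `]0, M]%classic (fun t => if a <= t then f t else 0) (F M - F a).
Proof.
move=> a0 aM dF df; have mD : measurable (`]0, M]%classic : set (measurableTypeR R)) by [].
have cf : {within `[a, M]%classic, continuous f}.
  apply: derivable_within_continuous => t; rewrite in_itv /= => /andP[at' _].
  by apply: df; exact: lt_le_trans at'.
have sub : (`]0, M] `&` `[a, M])%classic = `[a, M]%classic :> set R.
  apply/seteqP; split=> t /=; rewrite !in_itv /=; first by case.
  by move=> /andP[at' ->]; rewrite at' (lt_le_trans a0 at').
have fI : (@lebesgue_measure R).-integrable `[a, M]%classic (EFin \o f).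
  apply: continuous_compact_integrable => //; exact: segment_compact.
apply: (@has_integral_eq _ _ mD (f \_ `[a, M]%classic)).
  move=> t; rewrite /= in_itv /= => /andP[t0 tM]; rewrite patchE.
  case: ifPn; first by move/set_mem; rewrite /= in_itv /= => /andP[->].
  move/negP => h; rewrite ifF //; apply/negP => at'; apply: h; apply/mem_set.
  by rewrite /= in_itv /= at' tM.
split.
  have mI : measurable (`[a, M]%classic : set (measurableTypeR R)) by [].
  have [h _] := integrable_restrict lebesgue_measure mI mD (EFin \o f).
  by move: h; rewrite sub restrict_EFin; apply.
rewrite -Rintegral_mkcondr sub.
move: aM; rewrite le_eqVlt => /predU1P[->|aM].
  by rewrite set_itv1 Rintegral_set1 subrr.
rewrite /Rintegral (@continuous_FTC2 _ f F) //.
- split.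
  + by move=> t; rewrite in_itv /= => /andP[at' _]; have [] := dF _ (lt_trans a0 at').
  + apply: cvg_at_right_filter; apply: differentiable_continuous.
    by apply/derivable1_diffP; have [] := dF _ a0.
  + apply: cvg_at_left_filter; apply: differentiable_continuous.
    by apply/derivable1_diffP; have [] := dF _ (lt_trans a0 aM).
- move=> t; rewrite in_itv /= => /andP[at' _]; rewrite derive1E.
  by have [_ ->] := dF _ (lt_trans a0 at').
Qed.

Lemma sum_le_truncn (R : realType) (t c : R) (p : nat) : 0 <= t -> t < p.+1%:R ->
  \sum_(1 <= k < p.+1) (if k%:R <= t then c else 0) = (Num.truncn t)%:R * c.
Proof.
move=> t0 tp; have /andP[nt tn] := truncn_itv t0; set n := Num.truncn t in nt tn *.
have np : (n <= p)%N by rewrite -ltnS -(ltr_nat R) (le_lt_trans nt).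
rewrite (@big_cat_nat _ _ _ n.+1) //= (eq_big_nat _ _ (F2 := fun=> c)); last first.
  by move=> k /andP[_ kn]; rewrite ifT // (le_trans _ nt) // ler_nat -ltnS.
rewrite sumr_const_nat subn1 /= [X in _ + X]big_nat_cond [X in _ + X]big1 ?addr0 ?mulr_natl //.
move=> k /andP[/andP[nk _] _]; rewrite ifF //; apply/negbTE; rewrite -ltNge.
by rewrite (lt_le_trans tn) // ler_nat.
Qed.

Lemma fracE (R : realType) (t : R) : 0 <= t -> Defs.frac t = t - (Num.truncn t)%:R.
Proof.
move=> t0; rewrite /Defs.frac truncn_floor t0 [_%:R]pmulrn.
by rewrite gez0_abs // floor_ge0.
Qed.

(** Expand the product of [t - floor t] and [x t - floor (x t)] and write both
    integer parts as sums of indicators of [m <= t] and [k / x <= t]. *)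
Lemma has_integral_autocorr (R : realType) (M x : R) : 0 < M -> 0 < x ->
  has_integral `]0, M]%classic
    (fun t => Defs.frac t * Defs.frac (x * t) / t ^+ 2) (autocorr_trunc M x).
Proof.
move=> M0 x0; have mD : measurable (`]0, M]%classic : set (measurableTypeR R)) by [].
have T0 : 0 < M * x by rewrite mulr_gt0.
set p := Num.truncn M; set q := Num.truncn (M * x).
have /andP[pM Mp] := truncn_itv (ltW M0); have /andP[qT Tq] := truncn_itv (ltW T0).
rewrite -/p in pM Mp; rewrite -/q in qT Tq.
have I1 a : 0 < a -> a <= M ->
    has_integral `]0, M]%classic (fun t => if a <= t then t^-1 else 0) (ln (M / a)).
  move=> a0 aM; rewrite ln_div ?posrE //.
  have d1 (t : R) : 0 < t -> is_derive t 1 (@ln R) t^-1 by exact: is_derive1_ln.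
  have d2 (t : R) : 0 < t -> derivable (fun t : R => t^-1) t 1.
    by move=> t0; apply: derivableV => //; rewrite gt_eqF.
  exact: (has_integral_cut a0 aM d1 d2).
have I2 a : 0 < a -> a <= M ->
    has_integral `]0, M]%classic (fun t => if a <= t then t ^- 2 else 0) (a^-1 - M^-1).
  move=> a0 aM; rewrite (_ : a^-1 - M^-1 = - M^-1 - - a^-1); last by ring.
  have d1 (t : R) : 0 < t -> is_derive t 1 (fun t : R => - t^-1) (t ^- 2).
    move=> t0; have n0 : id t != 0 by rewrite gt_eqF.
    apply: (is_derive_eq (is_deriveN (is_deriveV n0 (is_derive_id t 1)))).
    by rewrite /GRing.scale /=; field.
  have d2 (t : R) : 0 < t -> derivable (fun t : R => t ^- 2) t 1.
    move=> t0; apply: derivableV; first by rewrite expf_neq0 ?gt_eqF.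
    exact: exprn_derivable.
  exact: (has_integral_cut a0 aM d1 d2).
have I3 : has_integral `]0, M]%classic (fun=> x) (x * M).
  split.
    have sub : (`]0, M] : set (measurableTypeR R)) `<=` `[0, M].
      by move=> t; rewrite /= !in_itv /= => /andP[/ltW -> ->].
    apply: integrableS sub _ => //.
    apply: continuous_compact_integrable; first exact: segment_compact.
    by apply: continuous_subspaceT => t; exact: cst_continuous.
  rewrite Rintegral_cst //; congr (_ * _).
  by rewrite /= lebesgue_measure_itv /= lte_fin M0 oppr0 adde0.
have J1 : has_integral `]0, M]%classic
    (fun t => \sum_(1 <= m < p.+1) (if m%:R <= t then t^-1 else 0)) (log_sum M).
  apply: has_integral_sum => // m /andP[m0 mp]; apply: I1; first by rewrite ltr0n.
  by rewrite (le_trans _ pM) // ler_nat -ltnS.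
have J2 : has_integral `]0, M]%classic
    (fun t => \sum_(1 <= k < q.+1) (if k%:R / x <= t then t^-1 else 0)) (log_sum (M * x)).
  rewrite /log_sum (eq_big_nat _ _ (F2 := fun k => ln (M / (k%:R / x)))); last first.
    move=> k /andP[k0 _]; congr ln; field; rewrite gt_eqF //.
    by rewrite pnatr_eq0 -lt0n k0.
  apply: has_integral_sum => // k /andP[k0 kq]; apply: I1.
    by rewrite divr_gt0 ?ltr0n.
  by rewrite ler_pdivrMr // (le_trans _ qT) // ler_nat -ltnS.
have J3 : has_integral `]0, M]%classic
    (fun t => \sum_(1 <= m < p.+1) \sum_(1 <= k < q.+1)
       (if Num.max m%:R (k%:R / x) <= t then t ^- 2 else 0))
    (min_sum M x - p%:R * q%:R / M).
  have -> : min_sum M x - p%:R * q%:R / M =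
     \sum_(1 <= m < p.+1) \sum_(1 <= k < q.+1) ((Num.max m%:R (k%:R / x))^-1 - M^-1).
    rewrite /min_sum -/p -/q.
    under [RHS]eq_bigr do rewrite sumrB sumr_const_nat subn1 /=.
    rewrite sumrB sumr_const_nat subn1 /= -!mulrnA; congr (_ - _); last first.
      by rewrite -[RHS]mulr_natl natrM [q%:R * _]mulrC.
    apply: eq_big_nat => m /andP[m0 _]; apply: eq_big_nat => k /andP[k0 _].
    have m0' : 0 < m%:R :> R by rewrite ltr0n.
    have k0' : 0 < k%:R / x :> R by rewrite divr_gt0 ?ltr0n.
    rewrite -[x / k%:R]invf_div maxElt minElt ltf_pV2 ?posrE //.
    by case: ltgtP => [||->].
  apply: has_integral_sum => // m /andP[m0 mp]; apply: has_integral_sum => // k /andP[k0 kq].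
  apply: I2; first by rewrite lt_max ltr0n m0.
  rewrite ge_max; apply/andP; split; first by rewrite (le_trans _ pM) // ler_nat -ltnS.
  by rewrite ler_pdivrMr // (le_trans _ qT) // ler_nat -ltnS.
have J := has_integralD mD (has_integralD mD (has_integralD mD I3
   (has_integralZ mD (- x) J1)) (has_integralZ mD (-1) J2)) J3.
rewrite (_ : autocorr_trunc M x = x * M + - x * log_sum M + -1 * log_sum (M * x) +
   (min_sum M x - p%:R * q%:R / M)); last by rewrite /autocorr_trunc -/p -/q; ring.
apply: has_integral_eq J => // t; rewrite /= in_itv /= => /andP[t0 tM].
have t0' := ltW t0; have xt0 : 0 <= x * t by rewrite mulr_ge0 // ltW.
have tp : t < p.+1%:R by exact: le_lt_trans tM Mp.
have tq : x * t < q.+1%:R by rewrite (le_lt_trans _ Tq) // mulrC ler_pM2r.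
have E (c : R) : \sum_(1 <= k < q.+1) (if k%:R / x <= t then c else 0) = (Num.truncn (x * t))%:R * c.
  rewrite -(@sum_le_truncn _ _ c q) //; apply: eq_bigr => k _.
  by rewrite ler_pdivrMr // [t * x]mulrC.
have E2 : \sum_(1 <= m < p.+1) \sum_(1 <= k < q.+1)
       (if Num.max m%:R (k%:R / x) <= t then t ^- 2 else 0) =
   (Num.truncn t)%:R * ((Num.truncn (x * t))%:R * t ^- 2).
  rewrite -(@sum_le_truncn _ _ _ p) //; apply: eq_bigr => m _.
  under eq_bigr do rewrite ge_max.
  by case: ifP => _ /=; [exact: E|rewrite big1].
rewrite E E2 sum_le_truncn // !fracE //; field.
by rewrite gt_eqF.
Qed.

Lemma measurable_frac (R : realType) (D : set (measurableTypeR R)) (x : R) : measurable D ->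
  0 < x -> measurable_fun D (fun t : R => Defs.frac (x * t)).
Proof.
move=> mD x0; apply: measurable_funB.
  exact: mulrl_measurable.
apply: nondecreasing_measurable => // s t st.
by rewrite ler_int le_floor // ler_pM2l.
Qed.

Lemma integral_inv_sqr (R : realType) (M : R) : 0 < M ->
  (\int[@lebesgue_measure R]_(t in `[M, +oo[) (t ^- 2)%:E = (M^-1)%:E)%E.
Proof.
move=> M0.
have d1 (t : R) : 0 < t -> is_derive t 1 (fun t : R => - t^-1) (t ^- 2).
  move=> t0; have n0 : id t != 0 by rewrite gt_eqF.
  apply: (is_derive_eq (is_deriveN (is_deriveV n0 (is_derive_id t 1)))).
  by rewrite /GRing.scale /=; field.
rewrite (@ge0_continuous_FTC2y _ (fun t => t ^- 2) (fun t => - t^-1) M 0).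
- by rewrite sub0e -EFinN opprK.
- by move=> t Mt; rewrite invr_ge0 sqr_ge0.
- apply/continuous_within_itvcyP; split.
    move=> t; rewrite in_itv /= andbT => Mt; have t0 := lt_trans M0 Mt.
    apply: cvgV; first by rewrite expf_neq0 ?gt_eqF.
    exact: exprn_continuous.
  apply: cvg_at_right_filter; apply: cvgV; first by rewrite expf_neq0 ?gt_eqF.
  exact: exprn_continuous.
- rewrite -oppr0; apply: cvgN; apply/gtr0_cvgV0; first exact: nbhs_pinfty_gt.
  exact: cvg_id.
- by move=> t Mt; have [] := d1 t (lt_trans M0 Mt).
- apply: cvg_at_right_filter; apply: cvgN; apply: cvgV; first by rewrite gt_eqF.
  exact: cvg_id.
- move=> t; rewrite in_itv /= andbT => Mt; rewrite derive1E.
  by have [_ ->] := d1 t (lt_trans M0 Mt).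
Qed.

Lemma frac_itv (R : realType) (t : R) : 0 <= Defs.frac t <= 1.
Proof.
have /andP[h1 h2] := floor_itv t; rewrite /Defs.frac subr_ge0 h1 /=.
by move: h2; rewrite intrD; lra.
Qed.

(** Beyond [M] the integrand lies between 0 and [1 / t ^+ 2]. *)
Lemma autocorr_trunc_approx (R : realType) (M x : R) : 0 < M -> 0 < x ->
  `|autocorr x - autocorr_trunc M x| <= M^-1.
Proof.
move=> M0 x0; pose mu := @lebesgue_measure R.
pose f (t : R) := Defs.frac t * Defs.frac (x * t) / t ^+ 2.
have f0 t : 0 <= f t.
  have /andP[a0 _] := frac_itv t; have /andP[b0 _] := frac_itv (x * t).
  by rewrite divr_ge0 ?sqr_ge0 // mulr_ge0.
have mi (D : set (measurableTypeR R)) : measurable D -> D `<=` `]0, +oo[ ->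
    measurable_fun D (fun t : R => t ^- 2).
  move=> mD sD; apply: (measurable_funS _ sD) => //.
  apply: open_continuous_measurable_fun; first exact: interval_open.
  move=> t /set_mem; rewrite /= in_itv /= andbT => t0.
  apply: cvgV; first by rewrite expf_neq0 ?gt_eqF.
  exact: exprn_continuous.
have mf (D : set (measurableTypeR R)) : measurable D -> D `<=` `]0, +oo[ ->
    measurable_fun D f.
  move=> mD sD; apply: measurable_funM; first apply: measurable_funM.
  - have := measurable_frac mD (@ltr01 R).
    by under eq_fun do rewrite mul1r.
  - exact: measurable_frac.
  - exact: mi.
have [fi fv] := has_integral_autocorr M0 x0.
have D0 : (`]0, +oo[%classic : set (measurableTypeR R)) = `]0, M]%classic `|` `]M, +oo[%classic.
  apply/seteqP; split => t; rewrite /= !in_itv /= !andbT.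
    by move=> t0; have [h|h] := leP t M; [left; rewrite t0|right].
  by move=> [/andP[]//|]; exact: lt_trans.
have fin1 := integrable_fin_num (mu := mu) (measurable_itv _) fi.
have sc : `[M, +oo[ `<=` (`]0, +oo[%classic : set (measurableTypeR R)).
  by move=> t; rewrite /= !in_itv /= !andbT; exact: lt_le_trans.
have so : `]M, +oo[ `<=` (`]0, +oo[%classic : set (measurableTypeR R)).
  by move=> t; rewrite /= !in_itv /= !andbT; exact: lt_trans.
have I2 : (0 <= \int[mu]_(t in `]M, +oo[) (f t)%:E <= (M^-1)%:E)%E.
  apply/andP; split; first by apply: integral_ge0 => t _; rewrite lee_fin.
  rewrite integral_itv_obnd_cbnd; last by apply/measurable_EFinP; exact: mf.
  rewrite -integral_inv_sqr //; apply: ge0_le_integral => //.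
  - by move=> t _; rewrite lee_fin.
  - by apply/measurable_EFinP; exact: mf.
  - by apply/measurable_EFinP; exact: mi.
  - move=> t _; rewrite lee_fin /f ler_piMl ?invr_ge0 ?sqr_ge0 //.
    have /andP[a0 a1] := frac_itv t; have /andP[b0 b1] := frac_itv (x * t).
    by rewrite mulr_ile1.
have fin2 : (\int[mu]_(t in `]M, +oo[) (f t)%:E)%E \is a fin_num.
  move: I2 => /andP[h1 h2]; rewrite ge0_fin_numE //; exact: le_lt_trans h2 (ltry _).
have -> : autocorr x = autocorr_trunc M x + fine (\int[mu]_(t in `]M, +oo[) (f t)%:E)%E.
  rewrite -fv /autocorr /Rintegral -fineD //; congr fine.
  rewrite D0 ge0_integral_setU //.
  - by apply/measurable_EFinP; apply: mf; rewrite -?D0.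
  - by move=> t _; rewrite lee_fin f0.
  - apply/disj_setPS => t [/=]; rewrite !in_itv /= andbT => /andP[_ h] h2.
    by move: (lt_le_trans h2 h); rewrite ltxx.
rewrite addrAC subrr add0r ger0_norm ?fine_ge0 ?(andP I2).1 //.
by rewrite -lee_fin fineK // (andP I2).2.
Qed.

End TruncatedAutocorrelation.

(** * Harmonic sums *)

Lemma ln_le_sub1 (R : realType) (y : R) : 0 < y -> ln y <= y - 1.
Proof.
move=> y0; rewrite -[in leLHS](subrKC 1 y) le_ln1Dx //; lra.
Qed.

Lemma ln_ratio_le (R : realType) (a b : R) : 0 < a -> 0 < b -> ln b - ln a <= (b - a) / a.
Proof.
move=> a0 b0; rewrite -ln_div ?posrE // (le_trans (ln_le_sub1 (divr_gt0 b0 a0))) //.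
by rewrite mulrBl divff ?gt_eqF.
Qed.

(** By induction on [p], as [1 / (p + 1) <= ln ((p + 1) / p)]; the first term of
    the sum is at most [2 x <= 2]. *)
Lemma harmonic_tail_le (R : realType) (x : R) (p : nat) : 0 < x <= 1 ->
  \sum_(1 <= m < p.+1 | 1 <= 2 * x * m%:R) m%:R^-1 <=
  (if 1 <= 2 * x * p%:R then 2 + ln (2 * x * p%:R) else 0).
Proof.
move=> /andP[x0 x1]; have x2 : 0 < 2 * x by rewrite mulr_gt0.
elim: p => [|p IH].
  by rewrite big_geq // mulr0 ler10.
rewrite big_mkcond big_nat_recr //= -big_mkcond /=.
have lt0 : 2 * x * p%:R <= 2 * x * p.+1%:R by rewrite ler_pM2l // ler_nat.
case: ifPn => h1; last first.
  rewrite addr0 (le_trans IH) // ifF //; apply/negbTE.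
  by apply: contra h1 => h; exact: le_trans h lt0.
have p0 : 0 < p.+1%:R :> R by rewrite ltr0n.
case: ifPn IH => h2 IH; last first.
  have : p.+1%:R^-1 <= 2 * x by rewrite -[_^-1]mul1r ler_pdivrMr.
  have : 0 <= ln (2 * x * p.+1%:R) by rewrite ln_ge0.
  move=> l0 l1; apply: le_trans (lerD IH (lexx _)) _; rewrite add0r.
  by move: l0 l1; move: (ln _) (p.+1%:R^-1) => a b; lra.
have pp : 0 < p%:R :> R by rewrite -(pmulr_rgt0 _ x2) (lt_le_trans _ h2).
have := ln_ratio_le (mulr_gt0 x2 p0) (mulr_gt0 x2 pp).
rewrite (_ : (2 * x * p%:R - _) / _ = - p.+1%:R^-1).
  by move: (ln (2 * x * p.+1%:R)) (p.+1%:R^-1) => a b; lra.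
by rewrite -[in X in X - _]natr1 -[p.+1]addn1 natrD; field; rewrite natr1 !gt_eqF.
Qed.

Lemma harmonic_sum_le (R : realType) (p : nat) : (0 < p)%N ->
  harmonic_sum R p <= 2 + ln p%:R.
Proof.
move=> p0; have h : 0 < (2^-1 : R) <= 1 by apply/andP; split; lra.
have := harmonic_tail_le p h; rewrite mulfV // mul1r ler1n p0; apply: le_trans.
rewrite /harmonic_sum big_nat_cond [leRHS]big_nat_cond le_eqVlt; apply/orP; left.
by apply/eqP; apply: eq_bigl => k; rewrite ?mulfV // ?mul1r ler1n; case: k => [|k] //=; rewrite ?andbT.
Qed.

Lemma sum_inv_sqr_le (R : realType) (p : nat) :
  \sum_(1 <= m < p.+1) m%:R ^- 2 <= 2 - p%:R^-1 :> R.
Proof.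
elim: p => [|p IH]; first by rewrite big_geq // invr0 subr0.
rewrite big_nat_recr //=; case: p IH => [|p] IH.
  by rewrite big_geq // expr1n invr1; lra.
apply: le_trans (lerD IH (lexx _)) _.
have p0 : 0 < p.+1%:R :> R by rewrite ltr0n.
rewrite -[p.+2]addn1 natrD.
move: p0; move: (p.+1%:R) => a a0.
have a1 : 0 < a + 1 by lra.
suff : (a + 1) ^- 2 <= a^-1 - (a + 1)^-1 by lra.
rewrite (_ : a^-1 - _ = (a * (a + 1))^-1); last by field; rewrite !gt_eqF.
by rewrite lef_pV2 ?posrE ?mulr_gt0 ?exprn_gt0 // expr2 ler_pM2r //; lra.
Qed.

(** [harmonic_sum n - ln n] decreases, by at most [1 / n - 1 / (n + 1)] at each
    step; this avoids introducing its limit. *)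
Lemma harmonic_ln_monotone (R : realType) (q p : nat) : (0 < q <= p)%N ->
  0 <= (harmonic_sum R q - ln q%:R) - (harmonic_sum R p - ln p%:R) <= q%:R^-1 - p%:R^-1.
Proof.
move=> /andP[q0]; elim: p => [|p IH]; first by rewrite leqn0 => /eqP e; rewrite e in q0.
rewrite leq_eqVlt => /predU1P[<-|]; first by rewrite !subrr lexx.
rewrite ltnS => qp; move: (IH qp) => /andP[h1 h2].
rewrite /harmonic_sum [X in _ - (X - _)]big_nat_recr //= -/(harmonic_sum R p).
have p0 : 0 < p%:R :> R by rewrite ltr0n (leq_trans q0).
have p1 : 0 < p.+1%:R :> R by rewrite ltr0n.
have := ln_ratio_le p0 p1; have := ln_ratio_le p1 p0.
have -> : (p%:R - p.+1%:R) / p.+1%:R = - p.+1%:R^-1 :> R.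
  by rewrite -[p.+1]addn1 natrD; field; rewrite natr1 gt_eqF.
have -> : (p.+1%:R - p%:R) / p%:R = p%:R^-1 :> R.
  by rewrite -[p.+1]addn1 natrD; field; rewrite gt_eqF.
move: h1 h2; rewrite /harmonic_sum => h1 h2.
move: (ln p.+1%:R) (p.+1%:R^-1) h1 h2 => a b h1 h2 h3 h4.
by apply/andP; split; lra.
Qed.

Lemma harmonic_sub_ln (R : realType) (M x : R) : 0 < x <= 1 -> 1 <= M * x ->
  `|harmonic_sum R (Num.truncn M) - harmonic_sum R (Num.truncn (M * x)) + ln x|
    <= 4 / (M * x).
Proof.
move=> /andP[x0 x1] T1; set T := M * x in T1 *.
have T0 : 0 < T by exact: lt_le_trans T1.
have M0 : 0 < M by rewrite -(pmulr_lgt0 _ x0).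
have TM : T <= M by rewrite /T ler_piMr // ltW.
have /andP[pM Mp] := truncn_itv (ltW M0); have /andP[qT Tq] := truncn_itv (ltW T0).
set p := Num.truncn M in pM Mp *; set q := Num.truncn T in qT Tq *.
have q0 : (0 < q)%N by rewrite truncn_gt0.
have qp : (q <= p)%N by exact: le_truncn.
have qr : 0 < q%:R :> R by rewrite ltr0n.
have pr : 0 < p%:R :> R by rewrite ltr0n (leq_trans q0).
have qT2 : q%:R^-1 <= 2 / T.
  rewrite ler_pdivlMr // mulrC ler_pdivrMr //.
  have : 1 <= q%:R :> R by rewrite ler1n.
  by move: Tq; rewrite -natr1; lra.
have := harmonic_ln_monotone R (introT andP (conj q0 qp)).
have lx : ln x = ln T - ln M by rewrite /T lnM ?posrE //; ring.
have a1 := ln_ratio_le pr M0; have a2 := ln_ratio_le qr T0.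
have b1 : (M - p%:R) / p%:R <= p%:R^-1.
  by rewrite ler_piMl ?invr_ge0 ?(ltW pr) //; move: Mp; rewrite -natr1; lra.
have b2 : (T - q%:R) / q%:R <= q%:R^-1.
  by rewrite ler_piMl ?invr_ge0 ?(ltW qr) //; move: Tq; rewrite -natr1; lra.
have c1 : ln p%:R <= ln M by rewrite ler_ln ?posrE.
have c2 : ln q%:R <= ln T by rewrite ler_ln ?posrE.
have pi : 0 < p%:R^-1 :> R by rewrite invr_gt0.
have e : 4 / T = 2 * (2 / T) by field; rewrite gt_eqF.
rewrite lx ler_norml e => /andP[h1 h2]; apply/andP; split; lra.
Qed.

(** * Cancellation between paired tails *)

Lemma saw_tail_norm (R : realType) (K n : nat) (t : R) : 0 < `|t - n%:R| < 1 ->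
  `|saw_tail K t| = `|saw_tail0 K `|t - n%:R| |.
Proof.
have [h|h] := leP n%:R t.
  rewrite ger0_norm ?subr_ge0 // => H.
  by rewrite -[in LHS](subrKC n%:R t) saw_tail_addn.
rewrite distrC gtr0_norm ?subr_gt0 // => /andP[_ h1].
have H : 0 < n%:R - t < 1 by rewrite subr_gt0 h.
by have := saw_tail_subn K n H; rewrite subKr => ->; rewrite normrN.
Qed.

(** The tie [t = n + 1/2] goes to [n + 1]; one fixed side for all ties keeps
    [nearest] injective on points at distance at least 1. *)
Definition nearest (R : realType) (t : R) : nat := Num.truncn (t + 2^-1).

Lemma nearest_itv (R : realType) (t : R) : 0 <= t ->
  (nearest t)%:R - 2^-1 <= t < (nearest t)%:R + 2^-1.
Proof.
move=> t0; have /truncn_itv : 0 <= t + 2^-1 by lra.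
rewrite -/(nearest t) -[(nearest t).+1%:R]natr1 => /andP[h1 h2]; apply/andP; split; lra.
Qed.

Lemma nearest_dist (R : realType) (t : R) : 0 <= t -> `|t - (nearest t)%:R| <= 2^-1.
Proof. by move=> /nearest_itv /andP[h1 h2]; rewrite ler_norml; apply/andP; split; lra. Qed.

Lemma nearest_def (R : realType) (t : R) (n : nat) : `|t - n%:R| < 2^-1 -> nearest t = n.
Proof.
rewrite ltr_norml => /andP[h1 h2]; apply: truncn_def; rewrite -[n.+1%:R]natr1.
by apply/andP; split; lra.
Qed.

Lemma saw_tail_decay (R : realType) (K n : nat) (t : R) : 0 < `|t - n%:R| <= 2^-1 ->
  `|saw_tail K t| <= 3 / ((2 * K%:R + 1) * `|t - n%:R|).
Proof.
move=> /andP[h1 h2]; rewrite (@saw_tail_norm _ _ n) ?saw_tail0_decay ?h1 //=.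
by apply: le_lt_trans h2 _; lra.
Qed.

Lemma saw_tail_bounded (R : realType) (K : nat) (t : R) : 0 <= t -> `|saw_tail K t| <= 6.
Proof.
move=> t0; have h := nearest_dist t0; set n := nearest t in h.
have [e|ne] := eqVneq t n%:R; first by rewrite e saw_tail_nat normr0.
have h0 : 0 < `|t - n%:R| by rewrite normr_gt0 subr_eq0.
rewrite (@saw_tail_norm _ _ n) ?saw_tail0_bounded ?h0 //=.
by apply: le_lt_trans h _; lra.
Qed.

(** [K m] and [L h] are the cutoffs of the partial sums at [m x] and [h / x].  Both
    sums produced by the hyperbola method are of this form. *)
Section Pairing.
Variables (R : realType) (M x C : R) (K L : nat -> nat).
Hypotheses (x01 : 0 < x <= 1) (T1 : 1 <= M * x) (C0 : 0 <= C).
Let T := M * x.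
Let p := Num.truncn M.
Let q := Num.truncn T.
Hypothesis KM : forall m, (0 < m <= p)%N -> M <= 2 * (K m)%:R + 1.
Hypothesis cmp : forall (h m : nat) (s : R), (0 < h < q)%N -> (0 < m <= p)%N ->
  0 < s <= 2^-1 -> `|h%:R - m%:R * x| = x * s ->
  `|saw_tail0 (L h) s - saw_tail0 (K m) (x * s)| <= C / T.

Let f m : R := saw_tail (K m) (m%:R * x) / m%:R.
Let g h : R := x * (saw_tail (L h) (h%:R / x) / h%:R).
(* The index paired with [h]. *)
Let mu (h : nat) : nat := nearest (h%:R / x).

Let x0 : 0 < x. Proof. by case/andP: x01. Qed.
Let x1 : x <= 1. Proof. by case/andP: x01. Qed.
Let T0 : 0 < T. Proof. exact: lt_le_trans T1. Qed.
Let M0 : 0 < M. Proof. by rewrite -(pmulr_lgt0 _ x0). Qed.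
Let TM : T <= M. Proof. by rewrite /T ler_piMr // ltW. Qed.
Let pM : p%:R <= M. Proof. by rewrite truncn_le ltW. Qed.
Let qT : q%:R <= T. Proof. by rewrite truncn_le ltW. Qed.
Let Tq : T < q%:R + 1. Proof. by rewrite natr1 truncnS_gt. Qed.
Let q0 : (0 < q)%N. Proof. by rewrite truncn_gt0. Qed.
Let q1 : 1 <= q%:R :> R. Proof. by rewrite ler1n. Qed.

Lemma mu_itv h : (mu h)%:R - 2^-1 <= h%:R / x < (mu h)%:R + 2^-1.
Proof. by apply: nearest_itv; rewrite divr_ge0 // ltW. Qed.

Lemma inv_x_ge1 : 1 <= x^-1. Proof. by rewrite invf_ge1. Qed.

Lemma mu_gt0 h : (0 < h)%N -> (0 < mu h)%N.
Proof.
move=> h0; have /andP[_ h2] := mu_itv h; rewrite -(ltr0n R).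
have : 1 <= h%:R / x by rewrite ler_pdivlMr // mul1r (le_trans x1) // ler1n.
lra.
Qed.

(** The points [h / x] are at distance at least 1 since [x <= 1]. *)
Lemma mu_lt h k : (h < k)%N -> (mu h < mu k)%N.
Proof.
move=> hk; have /andP[h1 h2] := mu_itv h; have /andP[k1 k2] := mu_itv k.
have : h%:R / x + 1 <= k%:R / x.
  apply: (@le_trans _ _ ((h%:R + 1) / x)).
    by rewrite mulrDl lerD2l mul1r inv_x_ge1.
  by rewrite ler_pM2r ?invr_gt0 // natr1 ler_nat.
by rewrite -(ltr_nat R); lra.
Qed.

Lemma mu_inj : injective mu.
Proof.
move=> h k e; case: (ltngtP h k) => // hk; move: (mu_lt hk); rewrite e ltnn //.
Qed.

(** Needs [h < q]: the last index [q] may be sent beyond [M]. *)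
Lemma mu_le h : (h < q)%N -> (mu h <= p)%N.
Proof.
move=> hq; rewrite truncn_ge_nat ?(ltW M0) //.
have /andP[h1 h2] := mu_itv h.
have : h%:R / x + 1 <= M.
  apply: (@le_trans _ _ ((h%:R + 1) / x)).
    by rewrite mulrDl lerD2l mul1r inv_x_ge1.
  by rewrite ler_pdivrMr // natr1 (le_trans _ qT) // ler_nat.
lra.
Qed.

(** The two tails have opposite signs and nearly equal weights: the weights
    differ by [x s / (m h)], which the decay [1 / (M x s)] of the tail
    compensates. *)
Lemma pair_bound h : (0 < h < q)%N -> `|f (mu h) + g h| <= (C + 3) / T * h%:R^-1.
Proof.
move=> hq; have /andP[h0 hq'] := hq.
set m := mu h; have mp : (0 < m <= p)%N by rewrite mu_gt0 // mu_le.
have hr : 0 < h%:R :> R by rewrite ltr0n.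
have mr : 0 < m%:R :> R by rewrite ltr0n mu_gt0.
have m1 : 1 <= m%:R :> R by rewrite ler1n mu_gt0.
have dist : `|h%:R / x - m%:R| <= 2^-1 by apply: nearest_dist; rewrite divr_ge0 // ltW.
set s := `|h%:R / x - m%:R| in dist.
have hm : h%:R - m%:R * x = x * (h%:R / x - m%:R) by field; rewrite gt_eqF.
have [e|ne] := eqVneq (h%:R / x - m%:R) 0.
  have e1 : h%:R / x = m%:R by apply/eqP; rewrite -subr_eq0 e.
  have e2 : m%:R * x = h%:R by rewrite -e1 divfK ?gt_eqF.
  rewrite /f /g e1 e2 !saw_tail_nat !mul0r mulr0 addr0 normr0.
  by rewrite mulr_ge0 ?invr_ge0 ?divr_ge0 ?addr_ge0 // ltW.
have s0 : 0 < s by rewrite normr_gt0.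
have s01 : 0 < s <= 2^-1 by rewrite s0.
have hms : `|h%:R - m%:R * x| = x * s by rewrite hm normrM gtr0_norm.
have xs0 : 0 < x * s by rewrite mulr_gt0.
have xss : x * s <= s by rewrite ler_piMl // ltW.
have s1 : 0 < s < 1 by rewrite s0 /=; lra.
have xs1 : 0 < x * s < 1 by rewrite xs0 /=; lra.
have xs2 : 0 < x * s <= 2^-1 by rewrite xs0 /=; lra.
have -> : `|f m + g h| = `|x / h%:R * (saw_tail0 (L h) s - saw_tail0 (K m) (x * s))
     + (x / h%:R - m%:R^-1) * saw_tail0 (K m) (x * s)|.
  rewrite /f /g; have [e0|e0] := ltP 0 (h%:R / x - m%:R).
    have es : s = h%:R / x - m%:R by rewrite /s gtr0_norm.
    have -> : h%:R / x = m%:R + s by rewrite es; ring.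
    have -> : m%:R * x = h%:R - x * s by rewrite es -hm; ring.
    by rewrite saw_tail_subn // saw_tail_addn //; congr (`|_|); ring.
  have es : s = - (h%:R / x - m%:R) by rewrite /s ler0_norm.
  have -> : h%:R / x = m%:R - s by rewrite es; ring.
  have -> : m%:R * x = h%:R + x * s by rewrite es mulrN -hm; ring.
  by rewrite saw_tail_subn // saw_tail_addn // -[RHS]normrN; congr (`|_|); ring.
have -> : (C + 3) / T * h%:R^-1 = C / T * h%:R^-1 + 3 / T * h%:R^-1 by ring.
rewrite (le_trans (ler_normD _ _)) // lerD //.
  have xh0 : 0 <= x / h%:R by rewrite divr_ge0 // ltW.
  rewrite normrM (ger0_norm xh0) mulrC; apply: ler_pM => //; first exact: cmp.
  by rewrite ler_piMl ?invr_ge0.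
have -> : x / h%:R - m%:R^-1 = - ((h%:R - m%:R * x) / (m%:R * h%:R)).
  by field; rewrite !gt_eqF.
rewrite normrM normrN normrM hms [`|_^-1|]ger0_norm ?invr_ge0 ?mulr_ge0 //.
have aM : M <= 2 * (K m)%:R + 1 by exact: KM.
have a0 : 0 < 2 * (K m)%:R + 1 :> R by exact: lt_le_trans aM.
apply: (@le_trans _ _ (x * s / (m%:R * h%:R) * (3 / ((2 * (K m)%:R + 1) * (x * s))))).
  by rewrite ler_wpM2l ?saw_tail0_decay // divr_ge0 ?mulr_ge0 // ltW.
have -> : x * s / (m%:R * h%:R) * (3 / ((2 * (K m)%:R + 1) * (x * s))) =
   3 / ((2 * (K m)%:R + 1) * m%:R) * h%:R^-1.
  by field; rewrite !gt_eqF.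
rewrite ler_pM2r ?invr_gt0 // ler_pM2l // lef_pV2 ?posrE ?mulr_gt0 //.
apply: le_trans TM _; apply: le_trans aM _.
by rewrite ler_peMr // ltW.
Qed.

Let paired := map mu (index_iota 1 q).

Lemma sum_paired : \sum_(1 <= m < p.+1 | m \in paired) f m = \sum_(1 <= h < q) f (mu h).
Proof.
rewrite -big_filter -[RHS](big_map mu xpredT f); apply: perm_big; apply: uniq_perm.
- by rewrite filter_uniq // iota_uniq.
- by rewrite map_inj_uniq ?iota_uniq //; exact: mu_inj.
move=> m; rewrite mem_filter; apply/andb_idr => /mapP[h]; rewrite mem_index_iota.
by move=> /andP[h0 hq] ->; rewrite mem_index_iota ltnS mu_gt0 // mu_le.
Qed.

(** Below [1 / (2 x)] the integer nearest to [m x] is 0 and the decay gives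
    [1 / (T m)] for the tail.  Otherwise [m x] is at distance at least [x / 2]
    from the integers, unless [m] is the integer nearest to [n / x] for some
    [n]; such an [m] escapes pairing only for [n = q] and [n = q + 1], and then
    [m] is of order [M]. *)
Lemma unpaired_bound m : (0 < m <= p)%N -> m \notin paired ->
  `|f m| <= 6 / T * (if 1 <= 2 * x * m%:R then m%:R^-1 else 0) + 3 / T * m%:R ^- 2
     + (24 / T * (m == mu q)%:R + 24 / T * (m == mu q.+1)%:R).
Proof.
move=> mp mI; have /andP[m0 mp'] := mp; have Tq' := Tq; have q1' := q1.
have mr : 0 < m%:R :> R by rewrite ltr0n.
have mx0 : 0 < m%:R * x by rewrite mulr_gt0.
have aM : M <= 2 * (K m)%:R + 1 by exact: KM.
have a0 : 0 < 2 * (K m)%:R + 1 :> R by exact: lt_le_trans aM.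
have nn1 : 0 <= 6 / T * (if 1 <= 2 * x * m%:R then m%:R^-1 else 0).
  by rewrite mulr_ge0 ?divr_ge0 ?(ltW T0) //; case: ifP => // _; rewrite invr_ge0.
have nn2 : 0 <= 3 / T * m%:R ^- 2.
  by rewrite mulr_ge0 ?divr_ge0 ?invr_ge0 ?sqr_ge0 ?(ltW T0).
have nn3 k : 0 <= 24 / T * (m == k)%:R by rewrite mulr_ge0 ?divr_ge0 ?(ltW T0).
have fE : `|f m| = `|saw_tail (K m) (m%:R * x)| / m%:R.
  by rewrite normrM [`|_^-1|]ger0_norm ?invr_ge0.
rewrite fE; have [h1|h1] := leP 1 (2 * x * m%:R); last first.
  suff : `|saw_tail (K m) (m%:R * x)| / m%:R <= 3 / T * m%:R ^- 2.
    by move: (nn3 (mu q)) (nn3 (mu q.+1)) nn1 => + + _; rewrite mulr0; lra.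
  have d0 : 0 < `|m%:R * x - 0%:R| <= 2^-1.
    by rewrite subr0 gtr0_norm // mx0 /=; lra.
  rewrite ler_pdivrMr // (le_trans (saw_tail_decay _ d0)) // subr0 gtr0_norm //.
  have -> : 3 / T * m%:R ^- 2 * m%:R = 3 / (T * m%:R) by field; rewrite !gt_eqF.
  rewrite ler_pM2l // lef_pV2 ?posrE ?mulr_gt0 // /T -mulrA [x * _]mulrC.
  by rewrite ler_pM2r.
set n := nearest (m%:R * x); set s := `|m%:R * x - n%:R|.
have ds : s <= 2^-1 by exact: nearest_dist (ltW mx0).
have /andP[n1 n2] := nearest_itv (ltW mx0); rewrite -/n in n1 n2.
have n0 : (0 < n)%N by rewrite truncn_gt0; lra.
have nr1 : 1 <= n%:R :> R by rewrite ler1n.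
have [h2|h2] := leP (x / 2) s.
  suff : `|saw_tail (K m) (m%:R * x)| / m%:R <= 6 / T * m%:R^-1.
    by move: (nn3 (mu q)) (nn3 (mu q.+1)) nn2; lra.
  have s0 : 0 < s <= 2^-1 by rewrite ds (lt_le_trans _ h2) // divr_gt0.
  rewrite ler_pM2r ?invr_gt0 // (le_trans (saw_tail_decay _ s0)) //.
  have -> : 6 / T = 3 / (M * (x / 2)) by rewrite /T; field; rewrite !gt_eqF.
  rewrite ler_pM2l // lef_pV2 ?posrE ?mulr_gt0 ?(andP s0).1 ?divr_gt0 //.
  by rewrite ler_pM ?divr_ge0 ?(ltW M0) ?(ltW x0).
have mun : mu n = m.
  apply: nearest_def; have -> : n%:R / x - m%:R = - (m%:R * x - n%:R) / x.
    by field; rewrite gt_eqF.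
  rewrite normrM normrN -/s gtr0_norm ?invr_gt0 // ltr_pdivrMr //; lra.
have qn : (q <= n)%N.
  rewrite leqNgt; apply: contra mI => nq; rewrite -mun; apply: map_f.
  by rewrite mem_index_iota n0.
have mxT : m%:R * x <= T.
  by rewrite ler_pM2r // (le_trans _ pM) // ler_nat.
have nq : (n <= q.+1)%N.
  by rewrite -ltnS -(ltr_nat R) -[q.+2%:R]natr1 -[q.+1%:R]natr1; lra.
have mT : m%:R^-1 <= 4 / T.
  rewrite ler_pdivlMr // mulrC ler_pdivrMr //.
  have : q%:R <= n%:R :> R by rewrite ler_nat.
  move: h2; rewrite ltr_norml => /andP[h2 h3] qn'.
  have : m%:R * x <= m%:R by rewrite ler_piMr // ltW.
  lra.
have tb : `|saw_tail (K m) (m%:R * x)| / m%:R <= 24 / T.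
  have -> : 24 / T = 6 * (4 / T) by field; rewrite gt_eqF.
  by rewrite ler_pM ?invr_ge0 // saw_tail_bounded // ltW.
move: nn1; rewrite h1 => nn1.
have [e|ne] := eqVneq n q.
  rewrite (_ : (m == mu q) = true) ?mulr1; last by rewrite -e mun eqxx.
  by move: (nn3 (mu q.+1)); lra.
have e : n = q.+1 by apply/eqP; rewrite eqn_leq nq ltn_neqAle eq_sym ne.
rewrite (_ : (m == mu q.+1) = true) ?mulr1; last by rewrite -e mun eqxx.
by move: (nn3 (mu q)); lra.
Qed.

(** Sums the two preceding bounds.  Both harmonic sums are [O (1 + ln T)]: the one
    over unpaired [m <= M] because it starts at [1 / (2 x)]. *)
Lemma paired_tails :
  `|\sum_(1 <= m < p.+1) saw_tail (K m) (m%:R * x) / m%:R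
    + x * \sum_(1 <= h < q.+1) saw_tail (L h) (h%:R / x) / h%:R|
  <= (2 * C + 90) * ((1 + ln T) / T).
Proof.
have Tq' := Tq; have q1' := q1.
have l0 : 0 <= ln T by rewrite ln_ge0.
have Ti : 0 < T^-1 by rewrite invr_gt0.
have lqT : ln q%:R <= ln T by rewrite ler_ln ?posrE // ltr0n.
have CT : 0 <= (C + 3) / T by rewrite divr_ge0 ?addr_ge0 // ltW.
rewrite mulr_sumr (bigID (mem paired)) /= sum_paired.
rewrite (eq_bigr f) // [X in _ + X](eq_bigr g) //.
rewrite [X in _ + X]big_nat_recr //=.
set S1 := \sum_(1 <= h < q) _; set S2 := \sum_(1 <= m < p.+1 | _) _.
set S3 := \sum_(1 <= h < q) _.
have b1 : `|S1 + S3| <= (C + 3) / T * (2 + ln T).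
  rewrite /S1 /S3 -big_split /= (le_trans (ler_norm_sum _ _ _)) //.
  apply: (@le_trans _ _ (\sum_(1 <= h < q) (C + 3) / T * h%:R^-1)).
    rewrite big_nat_cond [leRHS]big_nat_cond; apply: ler_sum => h /andP[hq _].
    exact: pair_bound.
  rewrite -mulr_sumr ler_wpM2l //.
  apply: (@le_trans _ _ (harmonic_sum R q)).
    by rewrite /harmonic_sum big_nat_recr //= lerDl invr_ge0.
  by rewrite (le_trans (harmonic_sum_le R q0)) // lerD2l.
have b2 : `|g q| <= 12 / T.
  have qr : 0 < q%:R :> R by rewrite ltr0n.
  have h := @saw_tail_bounded R (L q) (q%:R / x) (divr_ge0 (ltW qr) (ltW x0)).
  have hq : q%:R^-1 <= 2 / T.
    by rewrite ler_pdivlMr // mulrC ler_pdivrMr //; lra.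
  rewrite /g !normrM (gtr0_norm x0) [`|_^-1|]ger0_norm ?invr_ge0 //.
  have -> : 12 / T = 1 * (6 * (2 / T)) by field; rewrite gt_eqF.
  by rewrite ler_pM ?(ltW x0) ?mulr_ge0 ?invr_ge0 // ler_pM ?invr_ge0.
have one k : \sum_(1 <= m < p.+1) (24 / T * (m == k)%:R) <= 24 / T.
  rewrite -mulr_sumr ler_piMr ?divr_ge0 ?(ltW T0) //.
  rewrite (eq_bigr (fun m => if m == k then 1 else 0)); last by move=> m _; case: eqP.
  rewrite -big_mkcond /= -(natr_sum _ _ _ (fun=> 1%N)) sum1_count.
  by rewrite count_uniq_mem ?iota_uniq // lern1 leq_b1.
have b3 : `|S2| <= 6 / T * (3 + ln T) + 6 / T + 48 / T.
  apply: (le_trans (ler_norm_sum _ _ _)).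
  apply: (@le_trans _ _ (\sum_(1 <= m < p.+1)
      (6 / T * (if 1 <= 2 * x * m%:R then m%:R^-1 else 0) + 3 / T * m%:R ^- 2
     + (24 / T * (m == mu q)%:R + 24 / T * (m == mu q.+1)%:R)))).
    rewrite big_mkcond big_nat_cond [leRHS]big_nat_cond; apply: ler_sum => m /andP[mp _].
    case: ifPn => [|_]; first exact: unpaired_bound.
    have T0' := ltW T0.
    by rewrite !addr_ge0 ?mulr_ge0 ?divr_ge0 ?invr_ge0 ?sqr_ge0 //; case: ifP.
  rewrite !big_split /= -!mulr_sumr -big_mkcond /=.
  have k1 := harmonic_tail_le p x01.
  have k1' : \sum_(1 <= m < p.+1 | 1 <= 2 * x * m%:R) m%:R^-1 <= 3 + ln T.
    apply: le_trans k1 _; case: ifPn => h; last by lra.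
    have pr : 0 < p%:R :> R.
      by rewrite -(pmulr_rgt0 _ (mulr_gt0 (ltr0Sn _ 1) x0)) (lt_le_trans _ h).
    have : 2 * x * p%:R <= 2 * T.
      by rewrite -mulrA ler_pM2l // mulrC ler_pM2r.
    rewrite -ler_ln ?posrE ?mulr_gt0 // [leRHS]lnM ?posrE //.
    have := @ln_le_sub1 R 2 (ltr0Sn _ 1); lra.
  have k2 := sum_inv_sqr_le R p; have k3 := one (mu q); have k4 := one (mu q.+1).
  rewrite -!mulr_sumr in k3 k4.
  have k1'' : 6 / T * \sum_(1 <= m < p.+1 | 1 <= 2 * x * m%:R) m%:R^-1 <= 6 / T * (3 + ln T).
    by rewrite ler_wpM2l // divr_ge0 // ltW.
  have k2' : 3 / T * \sum_(1 <= m < p.+1) m%:R ^- 2 <= 6 / T.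
    have -> : 6 / T = 3 / T * 2 by ring.
    rewrite ler_wpM2l ?divr_ge0 ?(ltW T0) // (le_trans k2) // lerBlDr lerDl.
    by rewrite invr_ge0.
  have e : 48 / T = 24 / T + 24 / T by field; rewrite gt_eqF.
  rewrite e; do 2?apply: lerD => //.
have -> : S1 + S2 + (S3 + g q) = (S1 + S3) + S2 + g q by ring.
have tri : `|S1 + S3 + S2 + g q| <= `|S1 + S3| + `|S2| + `|g q|.
  by rewrite (le_trans (ler_normD _ _)) // lerD2r ler_normD.
apply: le_trans tri _; apply: le_trans (lerD (lerD b1 b3) b2) _.
rewrite -subr_ge0.
have -> : (2 * C + 90) * ((1 + ln T) / T) - ((C + 3) / T * (2 + ln T) +
    (6 / T * (3 + ln T) + 6 / T + 48 / T) + 12 / T) = (C * ln T + 81 * ln T) / T.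
  by field; rewrite gt_eqF.
by rewrite divr_ge0 ?addr_ge0 ?mulr_ge0 // ltW.
Qed.

End Pairing.

(** * The approximate functional equation *)

(** The cutoffs [p] and [q] are within 1 of [M] and [M * x]. *)
Lemma compare_fixed_cutoff (R : realType) (M x s : R) : 0 < x <= 1 -> 1 <= M * x ->
  0 < s <= 2^-1 ->
  `|saw_tail0 (Num.truncn (M * x)) s - saw_tail0 (Num.truncn M) (x * s)| <= 72 / (M * x).
Proof.
move=> /andP[x0 x1] T1 /[dup] s01 /andP[s0 s1]; set T := M * x in T1 *.
have T0 : 0 < T by exact: lt_le_trans T1.
have M0 : 0 < M by rewrite -(pmulr_lgt0 _ x0).
have TM : T <= M by rewrite /T ler_piMr // ltW.
have /andP[pM Mp] := truncn_itv (ltW M0); have /andP[qT Tq] := truncn_itv (ltW T0).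
set p := Num.truncn M in pM Mp *; set q := Num.truncn T in qT Tq *.
have p0 : 0 <= p%:R :> R by []; have q0 : 0 <= q%:R :> R by [].
rewrite -[p.+1%:R]natr1 in Mp; rewrite -[q.+1%:R]natr1 in Tq.
have xs0 : 0 < x * s by rewrite mulr_gt0.
have xss : x * s <= s by rewrite ler_piMl // ltW.
have xs1 : 0 < x * s <= 2^-1 by rewrite xs0 (le_trans xss).
have a1 : T <= 2 * q%:R + 1 by lra.
have a2 : M <= 2 * p%:R + 1 by lra.
have := @saw_tail0_compare R q p s (x * s) (T * s) s01 xs1 (mulr_gt0 T0 s0).
have y1 : T * s <= (2 * q%:R + 1) * s by rewrite ler_pM2r.
have y2 : T * s <= (2 * p%:R + 1) * (x * s) by rewrite mulrA ler_pM2r // ler_pM2r.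
move=> /(_ y1 y2) H; apply: le_trans H _.
have i1 : (2 * q%:R + 1)^-1 <= T^-1 by rewrite lef_pV2 ?posrE //; lra.
have i2 : (2 * p%:R + 1)^-1 <= T^-1 by rewrite lef_pV2 ?posrE //; lra.
suff i3 : `|(2 * q%:R + 1) * s - (2 * p%:R + 1) * (x * s)| / (T * s) <= 3 / T.
  have fin (a b c z : R) : 0 <= c -> a <= c -> b <= c -> z <= 3 * c -> 24 * (a + b) + 3 * z <= 72 * c.
    by clear; lra.
  by apply: fin i1 i2 i3; rewrite invr_ge0 ltW.
have -> : (2 * q%:R + 1) * s - (2 * p%:R + 1) * (x * s)
  = (2 * (q%:R - p%:R * x) + (1 - x)) * s by ring.
have -> : 3 / T = 3 * s / (T * s) by field; rewrite !gt_eqF.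
rewrite ler_pM2r ?invr_gt0 ?mulr_gt0 // normrM (gtr0_norm s0) ler_pM2r //.
have h1 : q%:R - p%:R * x <= 1.
  have : (M - 1) * x <= p%:R * x by rewrite ler_pM2r //; lra.
  by rewrite mulrBl -/T mul1r; lra.
have h2 : - 1 <= q%:R - p%:R * x.
  have : p%:R * x <= T by rewrite ler_pM2r.
  lra.
rewrite ler_norml; apply/andP; split; lra.
Qed.

Lemma divn_truncn_itv (R : realType) (w : R) (m : nat) : 0 <= w -> (0 < m)%N ->
  ((Num.truncn w %/ m)%N%:R : R) <= w / m%:R < (Num.truncn w %/ m)%N%:R + 1.
Proof.
move=> w0 m0; have mr : 0 < m%:R :> R by rewrite ltr0n.
rewrite ler_pdivlMr // ltr_pdivrMr // natr1 -!natrM; apply/andP; split.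
  by apply: le_trans (_ : (Num.truncn w)%:R <= w); rewrite ?ler_nat ?leq_divM ?truncn_le.
apply: lt_le_trans (truncnS_gt w) _; rewrite ler_nat.
by rewrite ltn_ceil.
Qed.

(** The cutoffs are within 1 of [M ^+ 2 / m] and [T ^+ 2 / h].  With [h / x] at
    distance [s] from [m], the scaled distances differ by a relative amount
    [O (h / T ^+ 2 + s / m)], which is [O (1 / T)] for [s <= m / T]; for larger
    [s] the decay makes each tail [O (1 / T)]. *)
Lemma compare_hyperbola_cutoff (R : realType) (M x s : R) (h m : nat) :
  0 < x <= 1 -> 1 <= M * x -> (0 < h <= Num.truncn (M * x))%N ->
  (0 < m <= Num.truncn M)%N -> 0 < s <= 2^-1 -> `|h%:R - m%:R * x| = x * s ->
  `|saw_tail0 (Num.truncn ((M * x) ^+ 2) %/ h) s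
    - saw_tail0 (Num.truncn (M ^+ 2) %/ m) (x * s)| <= 72 / (M * x).
Proof.
move=> /andP[x0 x1] T1 /andP[h0 hq] /andP[m0 mp] /[dup] s01 /andP[s0 s1] hm.
set T := M * x in T1 hq *.
have T0 : 0 < T by exact: lt_le_trans T1.
have M0 : 0 < M by rewrite -(pmulr_lgt0 _ x0).
have TM : T <= M by rewrite /T ler_piMr // ltW.
have hr : 1 <= h%:R :> R by rewrite ler1n.
have mr : 1 <= m%:R :> R by rewrite ler1n.
have hr0 : 0 < h%:R :> R by rewrite ltr0n.
have mr0 : 0 < m%:R :> R by rewrite ltr0n.
have hT : h%:R <= T by move: hq; rewrite truncn_ge_nat // ltW.
have mM : m%:R <= M by move: mp; rewrite truncn_ge_nat // ltW.
have /andP[L1 L2] := divn_truncn_itv (exprn_ge0 2 (ltW T0)) h0.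
have /andP[K1 K2] := divn_truncn_itv (exprn_ge0 2 (ltW M0)) m0.
set L := (Num.truncn (T ^+ 2) %/ h)%N in L1 L2 *.
set K := (Num.truncn (M ^+ 2) %/ m)%N in K1 K2 *.
have L0 : 0 <= L%:R :> R by []; have K0 : 0 <= K%:R :> R by [].
have xs0 : 0 < x * s by rewrite mulr_gt0.
have xss : x * s <= s by rewrite ler_piMl // ltW.
have xs1 : 0 < x * s <= 2^-1 by rewrite xs0 (le_trans xss).
have Th : T <= T ^+ 2 / h%:R by rewrite ler_pdivlMr // expr2 ler_pM2l.
have Mm : M <= M ^+ 2 / m%:R by rewrite ler_pdivlMr // expr2 ler_pM2l.
have hm' : `|h%:R - m%:R * x| <= 2^-1 by rewrite hm (le_trans xss).
have mx2 : m%:R * x <= 2 * h%:R by move: hm'; rewrite ler_norml => /andP[]; lra.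
have h2m : h%:R <= 2 * m%:R :> R.
  have mx1 : m%:R * x <= m%:R by rewrite ler_piMr // ltW.
  move: hm'; rewrite ler_norml => /andP[_ hm1].
  lra.
(* Common lower bound of the scaled distances: [m x <= 2 h]. *)
pose y := T ^+ 2 / (2 * h%:R) * s.
have y0 : 0 < y by rewrite mulr_gt0 // divr_gt0 ?exprn_gt0 ?mulr_gt0.
have y1 : y <= (2 * L%:R + 1) * s.
  rewrite ler_pM2r //; apply: (@le_trans _ _ (T ^+ 2 / h%:R)); last by lra.
  rewrite ler_pM2l ?exprn_gt0 // lef_pV2 ?posrE ?mulr_gt0 //; lra.
have y2 : y <= (2 * K%:R + 1) * (x * s).
  rewrite mulrA ler_pM2r //; apply: (@le_trans _ _ (M ^+ 2 / m%:R * x)); last first.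
    by rewrite ler_pM2r //; lra.
  have -> : M ^+ 2 / m%:R * x = T ^+ 2 / (m%:R * x).
    by rewrite /T; field; rewrite !gt_eqF.
  by rewrite ler_pM2l ?exprn_gt0 // lef_pV2 ?posrE ?mulr_gt0.
(* For [s] beyond [m / T] the decay of each tail is enough. *)
have [ls|ls] := leP s (m%:R / T); last first.
  have d1 := saw_tail0_decay L s01; have d2 := saw_tail0_decay K xs1.
  have e1 : 3 / ((2 * L%:R + 1) * s) <= 3 / y.
    by rewrite ler_pM2l // lef_pV2 ?posrE //; apply: lt_le_trans y1.
  have e2 : 3 / ((2 * K%:R + 1) * (x * s)) <= 3 / y.
    by rewrite ler_pM2l // lef_pV2 ?posrE //; apply: lt_le_trans y2.
  have e3 : 6 / y <= 24 / T.
    rewrite ler_pdivrMr // mulrAC ler_pdivlMr //.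
    have : m%:R <= T * s by move: ls; rewrite ltr_pdivrMr // [s * T]mulrC; exact: ltW.
    move=> k; have : h%:R <= 2 * (T * s) by clear -k h2m; lra.
    have -> : 24 * y = 12 * T * (T * s / h%:R) by rewrite /y; field; rewrite gt_eqF.
    move=> k2; have : 2^-1 <= T * s / h%:R by rewrite ler_pdivlMr //; clear -k2; lra.
    by move=> k3; clear -k3 T0; nra.
  apply: (le_trans (ler_normB _ _)).
  have e4 : 72 / T = 24 / T + 24 / T + 24 / T by field; rewrite gt_eqF.
  have e5 : 6 / y = 3 / y + 3 / y by field; rewrite gt_eqF.
  have e6 : 0 <= 24 / T by rewrite divr_ge0 // ltW.
  by rewrite e4; move: d1 d2 e1 e2 e3; rewrite e5; clear -e6; lra.
have := @saw_tail0_compare R L K s (x * s) y s01 xs1 y0 y1 y2.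
move=> H; apply: le_trans H _.
have i1 : (2 * L%:R + 1)^-1 <= T^-1.
  by rewrite lef_pV2 ?posrE ?odd_gt0 //; clear -L2 Th L0; lra.
have i2 : (2 * K%:R + 1)^-1 <= T^-1.
  by rewrite lef_pV2 ?posrE ?odd_gt0 //; clear -K2 Mm TM K0; lra.
suff i3 : `|(2 * L%:R + 1) * s - (2 * K%:R + 1) * (x * s)| / y <= 8 / T.
  have fin (a b c z : R) : 0 <= c -> a <= c -> b <= c -> z <= 8 * c -> 24 * (a + b) + 3 * z <= 72 * c.
    by clear; lra.
  by apply: fin i1 i2 i3; rewrite invr_ge0 ltW.
have T2 : 0 < T ^+ 2 by rewrite exprn_gt0.
have k1 : `|(2 * L%:R + 1) - 2 * (T ^+ 2 / h%:R)| <= 1.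
  by clear -L1 L2; rewrite ler_norml; apply/andP; split; lra.
have k2 : `|((2 * K%:R + 1) - 2 * (M ^+ 2 / m%:R)) * x| <= 1.
  have k : `|(2 * K%:R + 1) - 2 * (M ^+ 2 / m%:R)| <= 1.
    by clear -K1 K2; rewrite ler_norml; apply/andP; split; lra.
  by rewrite normrM (gtr0_norm x0) -[leRHS]mulr1 ler_pM // ltW.
have k3 : `|2 * (T ^+ 2 / h%:R) - 2 * (M ^+ 2 / m%:R) * x| = 2 * T ^+ 2 * s / (m%:R * h%:R).
  have c0 : 0 <= 2 * T ^+ 2 / (x * (m%:R * h%:R)).
    by rewrite divr_ge0 ?mulr_ge0 // ltW.
  have -> : 2 * (T ^+ 2 / h%:R) - 2 * (M ^+ 2 / m%:R) * x =
      - ((h%:R - m%:R * x) * (2 * T ^+ 2 / (x * (m%:R * h%:R)))).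
    by rewrite /T; field; rewrite !gt_eqF.
  by rewrite normrN normrM hm (ger0_norm c0); field; rewrite !gt_eqF.
have k4 : `|(2 * L%:R + 1) - (2 * K%:R + 1) * x| <= 2 + 2 * T ^+ 2 * s / (m%:R * h%:R).
  have -> : (2 * L%:R + 1) - (2 * K%:R + 1) * x =
     ((2 * L%:R + 1) - 2 * (T ^+ 2 / h%:R)) - ((2 * K%:R + 1) - 2 * (M ^+ 2 / m%:R)) * x
     + (2 * (T ^+ 2 / h%:R) - 2 * (M ^+ 2 / m%:R) * x) by ring.
  apply: (le_trans (ler_normD _ _)); rewrite k3 lerD2r.
  by clear -k1 k2; apply: (le_trans (ler_normB _ _)); lra.
have -> : (2 * L%:R + 1) * s - (2 * K%:R + 1) * (x * s) =
   ((2 * L%:R + 1) - (2 * K%:R + 1) * x) * s by ring.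
rewrite normrM (gtr0_norm s0) ler_pdivrMr //.
apply: (@le_trans _ _ ((2 + 2 * T ^+ 2 * s / (m%:R * h%:R)) * s)).
  by rewrite ler_pM2r.
have -> : 8 / T * y = (4 * (T / h%:R)) * s by rewrite /y; field; rewrite !gt_eqF.
rewrite ler_pM2r //.
have j1 : 1 <= T / h%:R by rewrite ler_pdivlMr // mul1r.
have j2 : 2 * T ^+ 2 * s / (m%:R * h%:R) <= 2 * (T / h%:R).
  have -> : 2 * T ^+ 2 * s / (m%:R * h%:R) = 2 * (T / h%:R) * (s / (m%:R / T)).
    by field; rewrite !gt_eqF.
  have mT0 : 0 < m%:R / T by rewrite divr_gt0.
  have sm : s / (m%:R / T) <= 1 by rewrite ler_pdivrMr // mul1r.
  by rewrite ler_piMr // mulr_ge0 // divr_ge0 // ltW.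
clear -j1 j2; lra.
Qed.

Lemma truncn_sqr_itv (R : realType) (M : R) : 0 <= M ->
  (Num.truncn M * Num.truncn M <= Num.truncn (M ^+ 2) <
    (Num.truncn M).+1 * (Num.truncn M).+1)%N.
Proof.
move=> M0; have /andP[h1 h2] := truncn_itv M0.
rewrite truncn_ge_nat ?exprn_ge0 // truncn_lt_nat ?exprn_ge0 // !natrM -!expr2.
rewrite ltrXn2r //= andbT.
by rewrite lerXn2r ?nnegrE.
Qed.

(** In the reciprocity formula, truncating the three autocorrelations costs
    [2 / T] in all, the harmonic sums [2 / T] and the square [1 / (2 T)]. *)
Lemma saw_sum_approx (R : realType) (M x : R) : 0 < x <= 1 -> 1 <= M * x ->
  `|saw_sum M x - (- (2^-1 * ln x) - F x)| <= 6 / (M * x).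
Proof.
move=> /[dup] x01 /andP[x0 x1] T1.
have T0 : 0 < M * x by exact: lt_le_trans T1.
have M0 : 0 < M by rewrite -(pmulr_lgt0 _ x0).
have TM : M * x <= M by rewrite ler_piMr // ltW.
have MT : M^-1 <= (M * x)^-1 by rewrite lef_pV2 ?posrE.
rewrite (saw_sum_reciprocity M0 x0) /F.
have h1 := autocorr_trunc_approx M0 x0.
have h2 := autocorr_trunc_approx M0 (@ltr01 R).
have h3 := autocorr_trunc_approx T0 (@ltr01 R).
have h4 := harmonic_sub_ln x01 T1.
have /andP[pM Mp] := truncn_itv (ltW M0); have /andP[qT Tq] := truncn_itv (ltW T0).
set p := Num.truncn M in pM Mp h4 *; set q := Num.truncn (M * x) in qT Tq h4 *.
rewrite -[p.+1%:R]natr1 in Mp; rewrite -[q.+1%:R]natr1 in Tq.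
have h5 : 0 <= (x * p%:R - q%:R) ^+ 2 / (2 * (M * x)) <= 2^-1 * (M * x)^-1.
  rewrite divr_ge0 ?sqr_ge0 ?mulr_ge0 ?(ltW M0) ?(ltW x0) //= invfM mulrCA.
  rewrite ler_pM2l // ler_piMl ?invr_ge0 ?(ltW T0) //.
  rewrite -[leRHS](expr1n _ 2) -[_ ^+ 2](real_normK (num_real _)) lerXn2r ?nnegrE //.
  have k1 : x * (M - 1) <= x * p%:R by rewrite ler_pM2l //; lra.
  have k2 : x * p%:R <= x * M by rewrite ler_pM2l.
  by rewrite ler_norml; apply/andP; split; lra.
set A := autocorr x in h1 *; set A' := autocorr_trunc M x in h1 *.
set B := autocorr 1 in h2 h3 *; set B' := autocorr_trunc M 1 in h2 *.
set B2 := autocorr_trunc (M * x) 1 in h3 *.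
set E := (x * p%:R - q%:R) ^+ 2 / (2 * (M * x)) in h5 *.
set D := harmonic_sum R p - harmonic_sum R q in h4 *.
have -> : A' - x / 2 * B' - 2^-1 * B2 + (1 - x) / 2 * D - E -
    (- (2^-1 * ln x) - ((x + 1) / 2 * B - A - x / 2 * ln x)) =
    - (A - A') + x * (2^-1 * (B - B')) + 2^-1 * (B - B2) + (1 - x) * (2^-1 * (D + ln x)) - E.
  by field.
set u := (M * x)^-1 in MT h3 h4 h5 *.
have u0 : 0 <= u by rewrite invr_ge0 ltW.
have b2 : `|x * (2^-1 * (B - B'))| <= 2^-1 * u.
  rewrite normrM (gtr0_norm x0) normrM ger0_norm // -[leRHS]mul1r.
  by rewrite ler_pM ?(ltW x0) ?mulr_ge0 // ler_pM2l // (le_trans h2).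
have b4 : `|(1 - x) * (2^-1 * (D + ln x))| <= 2 * u.
  rewrite normrM [`|1 - x|]ger0_norm ?subr_ge0 // normrM ger0_norm //.
  have -> : 2 * u = 1 * (2^-1 * (4 * u)) by field.
  by rewrite ler_pM ?subr_ge0 ?mulr_ge0 // ?ler_pM2l //; lra.
move: h1 h3 b2 b4 h5; rewrite !ler_norml.
move=> /andP[a1 a2] /andP[a3 a4] /andP[a5 a6] /andP[a7 a8] /andP[a9 a10].
clear -a1 a2 a3 a4 a5 a6 a7 a8 a9 a10 MT u0; apply/andP; split; lra.
Qed.

(** With [M ^+ 2] as length of the sum, all points of the hyperbola have a
    coordinate at most [M]; the sawtooth occurs with weight [2 - 1]. *)
Lemma sin_sum_tails (R : realType) (M y : R) : 0 <= M ->
  let p := Num.truncn M in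
  pi^-1 * sin_sum (M ^+ 2) y = \sum_(1 <= m < p.+1) sawtooth (m%:R * y) / m%:R
   - pi^-1 * (2 * (\sum_(1 <= m < p.+1) saw_tail (Num.truncn (M ^+ 2) %/ m) (m%:R * y) / m%:R)
     - \sum_(1 <= m < p.+1) saw_tail p (m%:R * y) / m%:R).
Proof.
move=> M0 p; rewrite (sin_sum_hyperbola y (truncn_sqr_itv M0)) -/p.
have E (K : nat -> nat) : \sum_(1 <= m < p.+1) m%:R^-1 * sin_partial (K m) (m%:R * y) =
    pi * \sum_(1 <= m < p.+1) sawtooth (m%:R * y) / m%:R
    - \sum_(1 <= m < p.+1) saw_tail (K m) (m%:R * y) / m%:R.
  rewrite mulr_sumr -sumrB; apply: eq_bigr => m _; rewrite /saw_tail; ring.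
rewrite (E (fun m => Num.truncn (M ^+ 2) %/ m)%N) (E (fun=> p)).
have := @pi_gt0 R; move: (pi : R) => c c0.
by field; rewrite gt_eqF.
Qed.

Theorem proposition34 (R : realType) :
  exists C : R, forall x v : R, 0 < x -> x <= 1 -> 0 < v -> 2 <= x ^+ 2 * v ->
    `| (pi^-1 * sin_sum v x + x / pi * sin_sum (x ^+ 2 * v) x^-1)
       - (- (2^-1 * ln x) - F x) |
    <= C * ((x ^+ 2 * v) `^ (- 2^-1) * ln (x ^+ 2 * v) ^+ 2).
Proof.
exists 2000 => x v x0 x1 v0 N2.
have x01 : 0 < x <= 1 by rewrite x0.
pose M := Num.sqrt v; pose T := M * x.
have M0 : 0 < M by rewrite sqrtr_gt0.
have Mv : M ^+ 2 = v by rewrite sqr_sqrtr // ltW.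
have T0 : 0 < T by rewrite mulr_gt0.
have TN : T ^+ 2 = x ^+ 2 * v by rewrite exprMn Mv mulrC.
have T1 : 1 <= T.
  rewrite -(@ler_pXn2r _ 2) ?nnegrE // ?ltW // expr1n TN; lra.
rewrite -TN in N2 *; rewrite -Mv.
set p := Num.truncn M; set q := Num.truncn T.
have Mp : M < p%:R + 1 by rewrite natr1 truncnS_gt.
have E1 : `|\sum_(1 <= m < p.+1) saw_tail (Num.truncn (M ^+ 2) %/ m) (m%:R * x) / m%:R
    + x * \sum_(1 <= h < q.+1) saw_tail (Num.truncn (T ^+ 2) %/ h) (h%:R / x) / h%:R|
    <= (2 * 72 + 90) * ((1 + ln T) / T).
  apply: (@paired_tails R M x 72 (fun m => Num.truncn (M ^+ 2) %/ m)%N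
    (fun h => Num.truncn (T ^+ 2) %/ h)%N) => //.
    move=> m /andP[m0 mp].
    have /andP[_ h2] := divn_truncn_itv (exprn_ge0 2 (ltW M0)) m0.
    have mM : m%:R <= M by move: mp; rewrite truncn_ge_nat // ltW.
    have : M <= M ^+ 2 / m%:R by rewrite ler_pdivlMr ?ltr0n // expr2 ler_pM2l.
    by have := ler0n R (Num.truncn (M ^+ 2) %/ m); lra.
  move=> h m s /andP[h0 hq] mp s01 hm.
  by apply: compare_hyperbola_cutoff => //; rewrite h0 ltnW.
have E2 : `|\sum_(1 <= m < p.+1) saw_tail p (m%:R * x) / m%:R
    + x * \sum_(1 <= h < q.+1) saw_tail q (h%:R / x) / h%:R|
    <= (2 * 72 + 90) * ((1 + ln T) / T).
  apply: (@paired_tails R M x 72 (fun=> p) (fun=> q)) => //.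
    by move=> m _; have := ler0n R p; lra.
  by move=> h m s _ _ s01 _; exact: compare_fixed_cutoff.
have S := saw_sum_approx x01 T1; rewrite -/T in S.
have -> : pi^-1 * sin_sum (M ^+ 2) x + x / pi * sin_sum (T ^+ 2) x^-1 =
    pi^-1 * sin_sum (M ^+ 2) x + x * (pi^-1 * sin_sum (T ^+ 2) x^-1) by rewrite mulrA.
rewrite (sin_sum_tails x (ltW M0)) (sin_sum_tails x^-1 (ltW T0)) -/p -/q.
move: S E1 E2; rewrite /saw_sum -/T -/p -/q.
set s1 := \sum_(1 <= m < p.+1) sawtooth _ / _; set s2 := \sum_(1 <= m < q.+1) sawtooth _ / _.
set a1 := \sum_(1 <= m < p.+1) saw_tail (_ %/ m) _ / _.
set a2 := \sum_(1 <= m < q.+1) saw_tail (_ %/ m) _ / _.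
set b1 := \sum_(1 <= m < p.+1) saw_tail p _ / _.
set b2 := \sum_(1 <= m < q.+1) saw_tail q _ / _.
set W := - (2^-1 * ln x) - F x.
move=> S E1 E2.
have -> : s1 - pi^-1 * (2 * a1 - b1) + x * (s2 - pi^-1 * (2 * a2 - b2)) - W =
  (s1 + x * s2 - W) - pi^-1 * (2 * (a1 + x * a2) - (b1 + x * b2)) by ring.
have pi2 : pi^-1 <= 2^-1 :> R by rewrite lef_pV2 ?posrE ?pi_gt0 // pi_ge2.
have pi0 : 0 <= pi^-1 :> R by rewrite invr_ge0 pi_ge0.
have l0 : 0 <= ln T by rewrite ln_ge0.
have X0 : 0 <= (1 + ln T) / T by rewrite divr_ge0 ?addr_ge0 // ltW.
have B : `|pi^-1 * (2 * (a1 + x * a2) - (b1 + x * b2))| <=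
    2^-1 * (3 * ((2 * 72 + 90) * ((1 + ln T) / T))).
  rewrite normrM ger0_norm // ler_pM // (le_trans (ler_normB _ _)) //.
  by rewrite normrM ger0_norm //; lra.
have Ti : 0 < T^-1 by rewrite invr_gt0.
have S' : 6 / T <= 6 * ((1 + ln T) / T).
  by rewrite ler_pM2l // ler_peMl ?(ltW Ti) // lerDl.
apply: (le_trans (ler_normB _ _)).
apply: (@le_trans _ _ (360 * ((1 + ln T) / T))).
  by apply: le_trans (lerD S B) _; lra.
have lnN : ln (T ^+ 2) = 2 * ln T by rewrite lnXn // mulr_natl.
have powN : (T ^+ 2) `^ (- 2^-1) = T^-1.
  by rewrite powRN powR12_sqrt ?sqr_ge0 // sqrtr_sqr gtr0_norm.
have l2 : 2^-1 <= ln (T ^+ 2).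
  have : ln 2 <= ln (T ^+ 2) by rewrite ler_ln ?posrE // exprn_gt0.
  have i2 : 0 < (2^-1 : R) by [].
  have := ln_le_sub1 i2; rewrite lnV ?posrE //; clear; lra.
(* [1 + ln T] is at most [5 * l ^+ 2], since [l >= ln 2 >= 1/2]. *)
rewrite powN; set l := ln (T ^+ 2) in lnN l2 *.
have -> : 360 * ((1 + ln T) / T) = T^-1 * (360 * (1 + l / 2)) by rewrite lnN; field; rewrite gt_eqF.
have -> : 2000 * (T^-1 * l ^+ 2) = T^-1 * (2000 * l ^+ 2) by ring.
rewrite ler_pM2l //.
clear -l2; have h1 : l <= 2 * l ^+ 2 by rewrite expr2 mulrA ler_peMl //; lra.
lra.
Qed.
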